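(* Let $\mathcal{M}$ be a graph matroid family that is $1$-extendable. Then $\mathcal{M}$ has the Lovász-Yemini property (and hence the Whitney property).
   Context: All graphs are finite and simple and have no isolated vertices. A graph matroid family $\mathcal{M}$ assigns to every graph $G$ a matroid $\mathcal{M}(G)$ on $E(G)$ such that (i) every graph isomorphism $V(G)\to V(H)$ induces an isomorphism $\mathcal{M}(G)\to\mathcal{M}(H)$, and (ii) for every subgraph $H$ of $G$, $\mathcal{M}(H)$ is the restriction of $\mathcal{M}(G)$ to $E(H)$. Let $r(G)$ be the rank of $\mathcal{M}(G)$. $G$ is $\mathcal{M}$-independent if $r(G)=|E(G)|$; an $\mathcal{M}$-circuit is an $\mathcal{M}$-dependent graph $G$ with $G-e$ $\mathcal{M}$-independent for all $e\in E(G)$; $G$ is $\mathcal{M}$-rigid if $r(G)=r(K_{V(G)})$. $\mathcal{M}$ is nontrivial if some graph is $\mathcal{M}$-dependent; its dimensionality is then $d=\min\{\delta-1\}$ over minimum degrees $\delta$ of $\mathcal{M}$-circuits. $\mathcal{M}$ is unbounded if $r(K_n)$ is unbounded. For a positive integer $d$, the $d$-dimensional edge split operation replaces an edge $uv$ of a graph by a new vertex adjacent to $u$, $v$, and $d-1$ other existing vertices. $\mathcal{M}$ is $1$-extendable if it is nontrivial, unbounded, has dimensionality $d\ge1$, and the $d$-dimensional edge split operation preserves $\mathcal{M}$-independence. A graph $G$ is $\mathcal{M}$-reconstructible if every matroid isomorphism $\psi:E(G)\to E(H)$ between $\mathcal{M}(G)$ and $\mathcal{M}(H)$, for any graph $H$,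 is induced by a graph isomorphism $\varphi$ (i.e. $\psi(uv)=\varphi(u)\varphi(v)$). $\mathcal{M}$ has the Lovász-Yemini property if for some nonnegative integer $c$ every $c$-connected graph is $\mathcal{M}$-rigid, and the Whitney property if for some $c$ every $c$-connected graph is $\mathcal{M}$-reconstructible. *)

(* Defs.v *)
From HB Require Import structures.
From mathcomp Require Import all_boot all_order.
From mathcomp Require Import finmap.
Set Implicit Arguments. Unset Strict Implicit. Unset Printing Implicit Defensive.
Local Open Scope fset_scope.

(* Vertices are natural numbers; an edge {u,v} (u <> v) is stored as the
   ordered pair (min u v, max u v).  A graph is a finite set of edges; since
   graphs have no isolated vertices, the vertex set is determined by the
   edges. Every finite simple graph without isolated vertices is isomorphic
   to such a graph. *)
Definition edge := (nat * nat)%type.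
Definition graph := {fset edge}.

Definition mkedge (u v : nat) : edge := (minn u v, maxn u v).

Definition wf_graph (G : graph) : Prop := forall e, e \in G -> e.1 < e.2.

Definition verts (G : graph) : {fset nat} :=
  [fset e.1 | e in G] `|` [fset e.2 | e in G].

Definition is_matroid (E : {fset edge}) (I : {fset edge} -> bool) : Prop :=
  [/\ I fset0,
      (forall A, I A -> A `<=` E),
      (forall A B, I B -> A `<=` B -> I A) &
      (forall A B, I A -> I B -> #|` A| < #|` B| ->
         exists2 e, e \in B `\` A & I (e |` A))].

Definition emap (phi : nat -> nat) (e : edge) : edge := mkedge (phi e.1) (phi e.2).

Definition graph_iso (G H : graph) (phi : nat -> nat) : Prop :=
  {in verts G &, injective phi} /\ [fset emap phi e | e in G] = H.

Definition graph_matroid_family (M : graph -> {fset edge} -> bool) : Prop :=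
  [/\ (forall G, wf_graph G -> is_matroid G (M G)),
      (forall G H phi, wf_graph G -> wf_graph H -> graph_iso G H phi ->
         forall F, F `<=` G -> M G F = M H [fset emap phi e | e in F]) &
      (forall G H, wf_graph G -> H `<=` G ->
         forall F, F `<=` H -> M H F = M G F)].

Section Family.
Variable M : graph -> {fset edge} -> bool.

Definition rank (G : graph) : nat :=
  \max_(S <- fpowerset G | M G S) #|` S|.

Definition indep (G : graph) : Prop := rank G = #|` G|.

Definition circuit (C : graph) : Prop :=
  wf_graph C /\ ~ indep C /\ forall e, e \in C -> indep (C `\ e).

Definition complete (S : {fset nat}) : graph :=
  [fset ((u, v) : edge) | u in S, v in S & (u < v)%N].

Definition K_n (n : nat) : graph := complete [fset i | i in iota 0 n].

Definition rigid (G : graph) : Prop := rank G = rank (complete (verts G)).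

Definition deg (G : graph) (v : nat) : nat :=
  #|` [fset e in G | (e.1 == v) || (e.2 == v)]|.

Definition min_degree (G : graph) (delta : nat) : Prop :=
  (exists2 v, v \in verts G & deg G v = delta) /\
  (forall v, v \in verts G -> delta <= deg G v).

Definition nontrivial : Prop := exists G, wf_graph G /\ ~ indep G.

Definition dimensionality (d : nat) : Prop :=
  (exists C, circuit C /\ min_degree C d.+1) /\
  (forall C delta, circuit C -> min_degree C delta -> d.+1 <= delta).

Definition unbounded : Prop := forall b, exists n, b < rank (K_n n).

Definition edge_split (G : graph) (u v w : nat) (X : {fset nat}) : graph :=
  (G `\ mkedge u v) `|` [fset mkedge w x | x in u |` (v |` X)].

Definition edge_split_preserves_indep (d : nat) : Prop :=
  forall G u v w X, wf_graph G -> mkedge u v \in G -> u != v ->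
    w \notin verts G -> X `<=` verts G -> u \notin X -> v \notin X ->
    #|` X| = d.-1 -> indep G -> indep (edge_split G u v w X).

Definition one_extendable : Prop :=
  [/\ nontrivial, unbounded &
      exists d, [/\ dimensionality d, 1 <= d & edge_split_preserves_indep d]].

Definition adj_avoid (G : graph) (X : {fset nat}) : rel nat :=
  fun a b => [&& a \notin X, b \notin X & mkedge a b \in G].

Definition k_connected (c : nat) (G : graph) : Prop :=
  c < #|` verts G| /\
  forall X, X `<=` verts G -> #|` X| < c ->
    forall x y, x \in verts G `\` X -> y \in verts G `\` X ->
      exists p, path (adj_avoid G X) x p && (last x p == y).

Definition matroid_iso (G H : graph) (psi : edge -> edge) : Prop :=
  [/\ {in G &, injective psi}, [fset psi e | e in G] = H &
      forall F, F `<=` G -> M G F = M H [fset psi e | e in F]].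

Definition reconstructible (G : graph) : Prop :=
  forall H psi, wf_graph H -> matroid_iso G H psi ->
    exists phi, graph_iso G H phi /\ {in G, forall e, psi e = emap phi e}.

Definition lovasz_yemini : Prop :=
  exists c, forall G, wf_graph G -> k_connected c G -> rigid G.

Definition whitney : Prop :=
  exists c, forall G, wf_graph G -> k_connected c G -> reconstructible G.

End Family.

(* Main.v *)
From HB Require Import structures.
From mathcomp Require Import all_boot all_order all_algebra finmap zify ring lra.
Require Import Defs.
Set Implicit Arguments. Unset Strict Implicit. Unset Printing Implicit Defensive.
Local Open Scope fset_scope.
Local Open Scope nat_scope.

(* A non-rigid, highly connected graph that is vertex-minimal and closed in its
   matroid has no simplicial vertex: deleting one keeps the connectivity and
   lowers both r(G) and r(K_V) by d.  Hence every vertex v has two neighbours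
   that are not linked.  Build G by adding its vertices in random order: v
   contributes at least d to the rank unless it has fewer than d earlier
   neighbours (unlikely), and at least d + 1, by an edge split, when the unlinked
   pair and d + 1 neighbours precede it (probability about 1/3).  So
   r(G) >= (d + 1/4)|V|, which contradicts r(K_n) = d n + O(1).  The average over
   orderings is carried out by an explicit potential function on vertex subsets.

   For the Whitney property, M(G) of a highly connected G has no separation of
   small connectivity with both sides non-spanning.  A small vertex cut of a
   graph H with M(H) isomorphic to M(G) would give one, so H is highly connected,
   hence rigid, and |V(H)| = |V(G)| by comparing ranks.  Applied to G - v, this
   shows that the image of G - v misses exactly one vertex of H, and stars are
   mapped to stars. *)

(** * Matroid rank *)

Section Matroid.
Variables (T : choiceType) (I : {fset T} -> bool).
Hypothesis I0 : I fset0.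
Hypothesis Isub : forall A B, I B -> A `<=` B -> I A.
Hypothesis Iaug : forall A B, I A -> I B -> #|` A| < #|` B| ->
  exists2 e, e \in B `\` A & I (e |` A).

Definition mrank (A : {fset T}) : nat := \max_(S <- fpowerset A | I S) #|` S|.

Lemma card_le_rk A B : B `<=` A -> I B -> #|` B| <= mrank A.
Proof.
move=> BA IB; rewrite /mrank.
by apply: (@leq_bigmax_seq _ _ (fun S => I S) (fun S : {fset T} => #|` S|)); rewrite ?fpowersetE.
Qed.

Lemma rk_base A : exists B, [/\ B `<=` A, I B & #|` B| = mrank A].
Proof.
rewrite /mrank.
have: all (fun S => S `<=` A) (fpowerset A : seq _).
  by apply/allP => S; rewrite fpowersetE.
elim: (fpowerset A : seq _) => [|S s IH] /=.
  by move=> _; exists fset0; rewrite big_nil fsub0set I0 cardfs0.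
case/andP=> SA /IH [B [BA IB cB]]; rewrite big_cons.
case: ifP => IS; last by exists B.
case: (leqP #|` S| #|` B|) => h.
  by exists B; split=> //; rewrite -cB; apply/esym/maxn_idPr.
by exists S; split=> //; rewrite -cB; apply/esym/maxn_idPl/ltnW.
Qed.

Lemma rk_card A : mrank A <= #|` A|.
Proof. by have [B [BA _ <-]] := rk_base A; apply: fsubset_leq_card. Qed.

Lemma rk_indep A : I A -> mrank A = #|` A|.
Proof. by move=> IA; apply/eqP; rewrite eqn_leq rk_card card_le_rk. Qed.

Lemma indep_rk A : #|` A| <= mrank A -> I A.
Proof.
have [B [BA IB cB]] := rk_base A; rewrite -cB => h.
have <- // : B = A.
by apply/eqP; rewrite eqEfcard BA.
Qed.

Lemma rk_mono A B : A `<=` B -> mrank A <= mrank B.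
Proof.
move=> AB; have [C [CA IC <-]] := rk_base A.
by apply: card_le_rk => //; apply: fsubset_trans AB.
Qed.

Lemma indep_ext A G : I A -> A `<=` G ->
  exists B, [/\ A `<=` B, B `<=` G, I B & #|` B| = mrank G].
Proof.
move: {2}(mrank G - #|` A|) (leqnn (mrank G - #|` A|)) => n.
elim: n A => [|n IH] A hn IA AG.
  exists A; split=> //; apply/eqP; rewrite eqn_leq card_le_rk //=.
  by move: hn; rewrite leqn0 subn_eq0.
case: (leqP (mrank G) #|` A|) => h.
  by exists A; split=> //; apply/eqP; rewrite eqn_leq card_le_rk.
have [B [BG IB cB]] := rk_base G.
have [|e] := Iaug IA IB; first by rewrite cB.
rewrite inE => /andP[eA eB] IeA.
have [||X [h1 h2 h3 h4]] := IH _ _ IeA.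
- by rewrite cardfsU1 eA add1n subnS -ltnS prednK // subn_gt0.
- by rewrite fsubUset fsub1set AG (fsubsetP BG).
exists X; split=> //; apply: fsubset_trans h1; apply: fsubsetU1.
Qed.

(** A base of the intersection extends to a base [Z] of the union; the parts of [Z] in [A] and in
    [B] are independent, and together they count the elements of [Z] in the intersection twice. *)
Lemma rk_submod A B : mrank (A `|` B) + mrank (A `&` B) <= mrank A + mrank B.
Proof.
have [X [XA IX cX]] := rk_base (A `&` B).
have [|Z [XZ ZA IZ cZ]] := @indep_ext X (A `|` B) IX.
  by apply: (fsubset_trans XA); apply: (fsubset_trans (fsubsetIl _ _)); apply: fsubsetUl.
have eZ : Z = (Z `&` A) `|` (Z `&` B) by rewrite -fsetIUr; apply/esym/fsetIidPl.
have h : #|` Z| + #|` Z `&` (A `&` B)| = #|` Z `&` A| + #|` Z `&` B|.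
  rewrite {1}eZ -(cardfsUI (Z `&` A)); congr (_ + #|` _|).
  by apply/fsetP => x; rewrite !inE; case: (x \in Z); rewrite ?andbF //= andbT.
rewrite -cZ -cX; apply: (@leq_trans (#|` Z| + #|` Z `&` (A `&` B)|)).
  by rewrite leq_add2l; apply: fsubset_leq_card; rewrite fsubsetI XZ.
rewrite h; apply: leq_add; apply: card_le_rk; rewrite ?fsubsetIr //; apply: Isub IZ (fsubsetIl _ _).
Qed.

Lemma rk_subadd A B : mrank (A `|` B) <= mrank A + mrank B.
Proof. exact: leq_trans (leq_addr _ _) (rk_submod A B). Qed.

(** The rank gained by adding [B] does not increase as the set grows; equivalently, the local
    connectivity of [A] and [B] is monotone in [A]. *)
Lemma rk_connectivity_mono A A' B : A `<=` A' ->
  mrank A + mrank (A' `|` B) <= mrank A' + mrank (A `|` B).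
Proof.
move=> AA'; have := rk_submod A' (A `|` B).
rewrite fsetUA (fsetUidPl _ _ AA') addnC => h; apply: leq_trans h.
by rewrite leq_add2r; apply: rk_mono; rewrite fsubsetI AA' fsubsetUl.
Qed.

Lemma rk_span J L : J `<=` L -> (forall e, e \in L -> mrank (e |` J) = mrank J) -> mrank L = mrank J.
Proof.
move=> JL h; apply/eqP; rewrite eqn_leq (rk_mono JL) andbT leqNgt; apply/negP => lt.
have [B [BJ IB cB]] := rk_base J; have [X [XL IX cX]] := rk_base L.
have [|e] := Iaug IB IX; first by rewrite cB cX.
rewrite inE => /andP[eB eX] IeB.
have := card_le_rk (fsetUS [fset e] BJ) IeB.
by rewrite h ?(fsubsetP XL) // cardfsU1 eB cB add1n ltnn.
Qed.

Lemma dependent_circuit A : ~~ I A ->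
  exists C, [/\ C `<=` A, ~~ I C & forall e, e \in C -> I (C `\ e)].
Proof.
move: {2}(#|` A|) (leqnn #|` A|) => n; elim: n A => [|n IH] A hn dA.
  by move: hn dA; rewrite leqn0 cardfs_eq0 => /eqP->; rewrite I0.
case: (boolP (all (fun e => I (A `\ e)) (A : seq T))) => [/allP h|/allPn [e eA nI]].
  by exists A; split.
have [|C [CA h1 h2]] := IH _ _ nI.
  by move: hn; rewrite (cardfsD1 e A) eA.
by exists C; split=> //; apply: fsubset_trans CA (fsubD1set _ _).
Qed.

End Matroid.

(** Serves both for relabelling the vertices of a graph and for a matroid isomorphism [psi]. *)
Lemma rk_imfset (T T' : choiceType) (I : {fset T} -> bool) (I' : {fset T'} -> bool)
  (f : T -> T') (A : {fset T}) : I fset0 -> I' fset0 ->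
  {in A &, injective f} ->
  (forall F, F `<=` A -> I F = I' [fset f x | x in F]) ->
  mrank I' [fset f x | x in A] = mrank I A.
Proof.
move=> I0 I0' finj h.
have cf (F : {fset T}) : F `<=` A -> #|` [fset f x | x in F]| = #|` F|.
  move=> FA; apply: card_in_imfset => x y xF yF; apply: finj; exact: (fsubsetP FA).
apply/eqP; rewrite eqn_leq; apply/andP; split.
  have [B [BA IB <-]] := rk_base I0' [fset f x | x in A].
  set F := [fset x in A | f x \in B].
  have FA : F `<=` A by apply/fsubsetP => x; rewrite !inE /= => /andP[].
  have eB : B = [fset f x | x in F].
    apply/fsetP => y; apply/idP/imfsetP => [yB|[x /= xF ->]].
      have /imfsetP[x /= xA e] := fsubsetP BA _ yB.
      by exists x => //; rewrite !inE /= xA -e.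
    by move: xF; rewrite !inE /= => /andP[].
  by rewrite eB cf //; apply: card_le_rk => //; rewrite h // -eB.
have [B [BA IB <-]] := rk_base I0 A.
rewrite -(cf _ BA); apply: card_le_rk; last by rewrite -h.
by apply/fsubsetP => y /imfsetP[x /= xB ->]; apply: in_imfset; apply: (fsubsetP BA).
Qed.

(** * Graphs and families *)

Definition inc (v : nat) (e : edge) : bool := (e.1 == v) || (e.2 == v).

Lemma mkedgeC u v : mkedge u v = mkedge v u.
Proof. by rewrite /mkedge minnC maxnC. Qed.

Lemma mkedge_wf u v : u != v -> (mkedge u v).1 < (mkedge u v).2.
Proof. rewrite /mkedge /=; lia. Qed.

Lemma mkedgeE (e : edge) : e.1 < e.2 -> mkedge e.1 e.2 = e.
Proof. by case: e => u v /= h; rewrite /mkedge; congr (_, _); lia. Qed.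

Lemma inc_mkedge w u v : inc w (mkedge u v) = (w == u) || (w == v).
Proof. rewrite /inc /mkedge /=; lia. Qed.

Lemma mkedge_inj w : injective (mkedge w).
Proof. move=> x y; rewrite /mkedge => -[]; lia. Qed.

Lemma inc_wf_edge v (e : edge) : e.1 < e.2 -> inc v e ->
  exists2 x, x != v & e = mkedge v x.
Proof.
move=> we /orP[] /eqP ev; [exists e.2|exists e.1]; first by lia.
- by rewrite -ev mkedgeE.
- by lia.
- by rewrite -ev mkedgeC mkedgeE.
Qed.

Lemma inc2_edge u v (e : edge) : e.1 < e.2 -> u != v -> inc u e -> inc v e -> e = mkedge u v.
Proof.
case: e => a b; rewrite /inc /mkedge /= => ab uv h1 h2.
by congr (_, _); lia.
Qed.

(* The lock keeps [inE] from unfolding vertex sets. *)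
Definition vset : graph -> {fset nat} := locked verts.

Lemma vsetE G : vset G = verts G.
Proof. by rewrite /vset -lock. Qed.

Lemma in_vsetP (G : graph) v : reflect (exists2 e, e \in G & inc v e) (v \in vset G).
Proof.
apply: (iffP idP); rewrite vsetE inE.
  case/orP => /imfsetP [e /= eG ->]; exists e => //; by rewrite /inc eqxx ?orbT.
case=> e eG /orP[] /eqP <-; apply/orP; [left|right]; exact: in_imfset.
Qed.

Lemma vset_edge (G : graph) u v : mkedge u v \in G -> (u \in vset G) && (v \in vset G).
Proof.
by move=> h; apply/andP; split; apply/in_vsetP; exists (mkedge u v);
   rewrite // inc_mkedge eqxx ?orbT.
Qed.

Lemma vset_sub (G H : graph) : G `<=` H -> vset G `<=` vset H.
Proof.
move=> GH; apply/fsubsetP => v /in_vsetP [e eG ev]; apply/in_vsetP; exists e => //.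
exact: (fsubsetP GH).
Qed.

Lemma vsetU (G H : graph) : vset (G `|` H) = vset G `|` vset H.
Proof.
apply/fsetP => v; rewrite [RHS]in_fsetU; apply/in_vsetP/orP.
  by case=> e; rewrite in_fsetU => /orP[] eG ev; [left|right]; apply/in_vsetP; exists e.
by case=> /in_vsetP[e eG ev]; exists e; rewrite // inE eG ?orbT.
Qed.

Lemma wf_sub (G H : graph) : G `<=` H -> wf_graph H -> wf_graph G.
Proof. move=> /fsubsetP GH wH e /GH; exact: wH. Qed.

Lemma wfU (G H : graph) : wf_graph G -> wf_graph H -> wf_graph (G `|` H).
Proof. by move=> wG wH e; rewrite inE => /orP[/wG|/wH]. Qed.

Definition star (w : nat) (D : {fset nat}) : graph := [fset mkedge w x | x in D].

Lemma in_star w D e : reflect (exists2 x, x \in D & e = mkedge w x) (e \in star w D).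
Proof. exact: imfsetP. Qed.

Lemma card_star w D : #|` star w D| = #|` D|.
Proof. apply: card_imfset; exact: mkedge_inj. Qed.

Lemma wf_star w D : w \notin D -> wf_graph (star w D).
Proof.
move=> wD e /in_star[x xD ->]; apply: mkedge_wf; apply: contraNneq wD => ->; exact: xD.
Qed.

Lemma mem_star w D x : (mkedge w x \in star w D) = (x \in D).
Proof.
apply/in_star/idP => [[y yD /mkedge_inj -> //]|xD]; by exists x.
Qed.

Definition nbr (G : graph) (v : nat) : {fset nat} := [fset x in vset G | mkedge v x \in G].

Lemma in_nbr G v x : (x \in nbr G v) = (mkedge v x \in G).
Proof.
rewrite !inE /=; case h: (mkedge v x \in G); rewrite ?andbF // andbT.
by have /andP[] := vset_edge h.
Qed.

Lemma nbr_self G v : wf_graph G -> v \notin nbr G v.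
Proof. rewrite in_nbr => wG; apply/negP => /wG; rewrite /mkedge /=; lia. Qed.

Lemma nbr_neq G v x : wf_graph G -> x \in nbr G v -> x != v.
Proof. by move=> wG; apply: contraTneq => ->; apply: nbr_self. Qed.

Lemma nbr_vset G v : nbr G v `<=` vset G.
Proof. by apply/fsubsetP => x; rewrite in_nbr => /vset_edge /andP[]. Qed.

Lemma inc_star_nbr (G : graph) v : wf_graph G ->
  [fset e in G | inc v e] = star v (nbr G v).
Proof.
move=> wG; apply/fsetP => e; apply/idP/in_star.
  rewrite !inE /= => /andP[eG /(inc_wf_edge (wG _ eG)) [x xv e_]].
  by exists x; rewrite // in_nbr -e_.
by case=> x; rewrite in_nbr => h ->; rewrite !inE /= h inc_mkedge eqxx.
Qed.

Lemma deg_nbr (G : graph) v : wf_graph G -> deg G v = #|` nbr G v|.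
Proof. by move=> wG; rewrite -(card_star v) -inc_star_nbr. Qed.

Lemma in_complete (S : {fset nat}) (e : edge) :
  (e \in complete S) = [&& e.1 \in S, e.2 \in S & e.1 < e.2].
Proof.
case: e => a b; apply/imfset2P/idP => /=.
  by case=> x /= xS [y]; rewrite !inE /= => /andP[yS xy] [-> ->]; rewrite xS yS.
by case/and3P => aS bS ab; exists a => //; exists b; rewrite // !inE /= bS.
Qed.

Lemma wf_complete S : wf_graph (complete S).
Proof. by move=> e; rewrite in_complete => /and3P[]. Qed.

Lemma mkedge_complete S u v : (mkedge u v \in complete S) = [&& u \in S, v \in S & u != v].
Proof.
rewrite in_complete /mkedge /=; case: (ltngtP u v) => uv.
- by rewrite ?uv.
- by rewrite ?uv andbCA.
- by rewrite ?uv ?ltnn ?andbF.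
Qed.

Lemma sub_complete (G : graph) (S : {fset nat}) :
  wf_graph G -> (G `<=` complete S) = (vset G `<=` S).
Proof.
move=> wG; apply/fsubsetP/fsubsetP => h.
  move=> v /in_vsetP[e /h]; rewrite in_complete => /and3P[h1 h2 _].
  by case/orP => /eqP <-.
move=> e eG; rewrite in_complete (wG _ eG) andbT.
by apply/andP; split; apply: h; apply/in_vsetP; exists e; rewrite // /inc eqxx ?orbT.
Qed.

Lemma complete_sub S S' : S `<=` S' -> complete S `<=` complete S'.
Proof.
move=> /fsubsetP h; apply/fsubsetP => e; rewrite !in_complete => /and3P[h1 h2 ->].
by rewrite !h.
Qed.

Lemma vset_complete S : 1 < #|` S| -> vset (complete S) = S.
Proof.
move=> cS; apply/eqP; rewrite eqEfsubset; apply/andP; split.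
  by rewrite -sub_complete ?fsubset_refl //; apply: wf_complete.
apply/fsubsetP => x xS.
have : 0 < #|` S `\ x| by move: cS; rewrite (cardfsD1 x) xS.
rewrite cardfs_gt0 => /fset0Pn[y]; rewrite !inE => /andP[yx yS].
have h : mkedge x y \in complete S by rewrite mkedge_complete xS yS eq_sym.
by have /andP[] := vset_edge h.
Qed.

(** A vertex of [S] that becomes isolated disappears, so in general [vset (induced S G)] is only
    contained in [S]. *)
Definition induced (S : {fset nat}) (G : graph) : graph :=
  [fset e in G | (e.1 \in S) && (e.2 \in S)].

Lemma in_induced S G e : (e \in induced S G) = [&& e \in G, e.1 \in S & e.2 \in S].
Proof. by rewrite !inE. Qed.

Lemma induced_sub S G : induced S G `<=` G.
Proof. by apply/fsubsetP => e; rewrite in_induced => /andP[]. Qed.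

Lemma mkedge_induced S G u v :
  (mkedge u v \in induced S G) = [&& mkedge u v \in G, u \in S & v \in S].
Proof.
rewrite in_induced /mkedge /=; case: (leqP u v) => uv.
- by rewrite ?(minn_idPl uv) ?(maxn_idPr uv).
- by rewrite ?(minn_idPr (ltnW uv)) ?(maxn_idPl (ltnW uv)) [(v \in S) && _]andbC.
Qed.

Lemma vset_induced S G : vset (induced S G) `<=` S.
Proof.
apply/fsubsetP => x /in_vsetP [e]; rewrite in_induced => /and3P[_ h1 h2].
by case/orP => /eqP <-.
Qed.

Lemma induced_mono S S' G : S `<=` S' -> induced S G `<=` induced S' G.
Proof.
move=> /fsubsetP h; apply/fsubsetP => e; rewrite !in_induced => /and3P[-> h1 h2].
by rewrite !h.
Qed.

Lemma induced_full G : induced (vset G) G = G.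
Proof.
apply/fsetP => e; rewrite in_induced; case eG: (e \in G) => //=.
by apply/andP; split; apply/in_vsetP; exists e; rewrite // /inc eqxx ?orbT.
Qed.

(** * The independent edge sets of a graph matroid family *)

Section Family.
Variable M : graph -> {fset edge} -> bool.
Hypothesis hM : graph_matroid_family M.

Definition wfb (G : graph) : bool := all (fun e : edge => e.1 < e.2) G.

Lemma wfP G : reflect (wf_graph G) (wfb G).
Proof. exact: allP. Qed.

(* By restriction, independence of an edge set does not depend on the host
   graph; edge sets that are not graphs are declared dependent. *)
Definition ind (F : graph) : bool := wfb F && M F F.

Lemma family_restrict G F : wf_graph G -> F `<=` G -> M G F = ind F.
Proof.
case: hM => _ _ hr wG FG; rewrite /ind.
have -> : wfb F by apply/wfP; apply: wf_sub FG wG.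
by rewrite (hr G F).
Qed.

Lemma ind0 : ind fset0.
Proof.
case: hM => hm _ _; have wf0 : wf_graph fset0 by move=> e; rewrite inE.
by rewrite -(family_restrict wf0) //; case: (hm _ wf0).
Qed.

Lemma ind_wf F : ind F -> wf_graph F.
Proof. by case/andP=> /wfP. Qed.

Lemma ind_sub A B : ind B -> A `<=` B -> ind A.
Proof.
case: hM => hm _ _ iB AB; have wB := ind_wf iB.
rewrite -(family_restrict wB) //; have [_ _ h _] := hm _ wB.
by apply: h AB; case/andP: iB.
Qed.

Lemma ind_aug A B : ind A -> ind B -> #|` A| < #|` B| ->
  exists2 e, e \in B `\` A & ind (e |` A).
Proof.
case: hM => hm _ _ iA iB cAB; have wAB := wfU (ind_wf iA) (ind_wf iB).
have [_ hs _ h] := hm _ wAB.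
case: (h A B); rewrite ?family_restrict ?fsubsetUl ?fsubsetUr // => e eBA he.
by exists e => //; rewrite -(family_restrict wAB) //; apply: hs.
Qed.

Notation rk := (mrank ind).

Lemma rankE G : wf_graph G -> rank M G = rk G.
Proof.
move=> wG; rewrite /rank /mrank big_seq_cond [RHS]big_seq_cond.
apply: eq_bigl => S; case h: (S \in _) => //=.
by apply: family_restrict => //; rewrite fpowersetE in h.
Qed.

Lemma indepE G : wf_graph G -> (indep M G <-> ind G).
Proof.
move=> wG; rewrite /indep rankE //; split.
  by move=> h; apply: (indep_rk ind0); rewrite h.
by move=> h; apply: (rk_indep ind0).
Qed.

Lemma emap_mkedge (phi : nat -> nat) u v : emap phi (mkedge u v) = mkedge (phi u) (phi v).
Proof.
rewrite /emap {2}/mkedge /=; case: (leqP u v) => uv.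
- by rewrite ?(minn_idPl uv) ?(maxn_idPr uv).
- by rewrite ?(minn_idPr (ltnW uv)) ?(maxn_idPl (ltnW uv)) mkedgeC.
Qed.

Lemma wf_emap G phi : wf_graph G -> {in vset G &, injective phi} ->
  wf_graph [fset emap phi e | e in G].
Proof.
move=> wG inj e /imfsetP[[a b] /= abG ->]; rewrite /emap.
have ab := wG _ abG; have := vset_edge (u := a) (v := b) (G := G).
rewrite (mkedgeE ab) => /(_ abG) /andP[aG bG].
apply: mkedge_wf => /=; apply/eqP => /(inj _ _ aG bG) h.
by move: ab; rewrite /= h ltnn.
Qed.

Lemma emap_inj G phi : wf_graph G -> {in vset G &, injective phi} ->
  {in G &, injective (emap phi)}.
Proof.
move=> wG inj [a b] [a' b'] h h'; have /= ab := wG _ h; have /= ab' := wG _ h'.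
have := vset_edge (u := a) (v := b) (G := G).
have := vset_edge (u := a') (v := b') (G := G).
rewrite (mkedgeE (e := (a, b))) // (mkedgeE (e := (a', b'))) //.
move=> /(_ h') /andP[a'G b'G] /(_ h) /andP[aG bG] /= [e1 e2].
have : (phi a = phi a' /\ phi b = phi b') \/ (phi a = phi b' /\ phi b = phi a') by lia.
case=> -[h1 h2].
  by rewrite (inj _ _ aG a'G h1) (inj _ _ bG b'G h2).
by move: ab ab'; rewrite (inj _ _ aG b'G h1) (inj _ _ bG a'G h2); lia.
Qed.

Lemma ind_emap G phi : wf_graph G -> {in vset G &, injective phi} ->
  forall F, F `<=` G -> ind F = ind [fset emap phi e | e in F].
Proof.
case: hM => _ hi _ wG inj F FG; have wH := wf_emap wG inj.
have iso : graph_iso G [fset emap phi e | e in G] phi by split; rewrite -?vsetE.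
rewrite -(family_restrict wG FG) (hi G _ phi wG wH iso F FG).
apply: family_restrict => //; apply/fsubsetP => y /imfsetP[x /= xF ->].
by apply: in_imfset; apply: (fsubsetP FG).
Qed.

Lemma rk_emap G phi : wf_graph G -> {in vset G &, injective phi} ->
  rk [fset emap phi e | e in G] = rk G.
Proof.
move=> wG inj; apply: rk_imfset; [exact: ind0|exact: ind0| | exact: ind_emap].
exact: emap_inj.
Qed.

End Family.

(** * Extensions *)

Lemma subfset_of_card (T : choiceType) (D : {fset T}) n : n <= #|` D| ->
  exists2 D' : {fset T}, D' `<=` D & #|` D'| = n.
Proof.
move=> h; exists [fset x in take n D].
  by apply/fsubsetP => x; rewrite !inE => /mem_take.
rewrite card_fseq undup_id ?take_uniq ?fset_uniq // size_takel //.
Qed.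

Section Extensions.
Variable M : graph -> {fset edge} -> bool.
Hypothesis hM : graph_matroid_family M.
Variable d : nat.
Hypothesis hd : dimensionality M d.
Hypothesis d_gt0 : 0 < d.

Notation ind := (ind M).
Notation rk := (mrank ind).
Let I0 := ind0 hM.
Let Isub := @ind_sub M hM.
Let Iaug := @ind_aug M hM.

(** [dimensionality] speaks of minimum degrees only, so a vertex [u] of least degree is found first,
    by descent from [v]. *)
Lemma circuit_deg C v : wf_graph C -> ~~ ind C -> (forall e, e \in C -> ind (C `\ e)) ->
  v \in vset C -> d < #|` nbr C v|.
Proof.
move=> wC dC hC vC.
have cC : circuit M C.
  split=> //; split; first by move/(indepE hM wC) => h; rewrite h in dC.
  move=> e /hC h; apply/(indepE hM) => //; exact: ind_wf h.
have [u uC umin] : exists2 u, u \in vset C & forall x, x \in vset C -> deg C u <= deg C x.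
  have [n le_n] := ubnP (deg C v); elim: n v vC le_n => // n IH v vC le_n.
  case: (boolP (all (fun x => deg C v <= deg C x) (vset C))) => [/allP h|/allPn[x xC]].
    by exists v.
  by rewrite -ltnNge => lt; apply: (IH x) => //; apply: leq_trans lt _.
rewrite -deg_nbr //; apply: leq_trans (umin _ vC).
case: hd => _; apply; first exact: cC.
by split; [exists u; rewrite -?vsetE | rewrite -vsetE].
Qed.

(** A circuit through [w] would have degree at most [d] there, against [circuit_deg]; a circuit
    avoiding [w] would lie in [B]. *)
Lemma ind_zero_ext B w D : ind B -> w \notin vset B -> w \notin D -> #|` D| <= d ->
  ind (B `|` star w D).
Proof.
move=> iB wB wD cD; apply/negPn/negP => /(dependent_circuit I0)[C [CB dC hC]].
have wC : wf_graph C by apply: wf_sub CB (wfU (ind_wf iB) (wf_star wD)).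
case: (boolP (w \in vset C)) => wVC; last first.
  case/negP: dC; apply: Isub iB _; apply/fsubsetP => e eC.
  have := fsubsetP CB _ eC; rewrite in_fsetU => /orP[//|/in_star[x xD ee]].
  by case/negP: wVC; apply/in_vsetP; exists e; rewrite // ee inc_mkedge eqxx.
have := circuit_deg wC dC hC wVC; rewrite ltnNge => /negP; apply.
apply: leq_trans cD; apply: fsubset_leq_card; apply/fsubsetP => x; rewrite in_nbr => xC.
have := fsubsetP CB _ xC; rewrite in_fsetU mem_star => /orP[/vset_edge/andP[h _]|//].
by rewrite h in wB.
Qed.

Lemma rk_zero_ext Z w D : w \notin vset Z -> w \notin D ->
  rk Z + minn d #|` D| <= rk (Z `|` star w D).
Proof.
move=> wZ wD; have [D' D'D cD'] := subfset_of_card (geq_minr d #|` D|).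
have [B [BZ iB <-]] := rk_base I0 Z.
have wB : w \notin vset B by apply: contra wZ; apply/fsubsetP/vset_sub.
have wD' : w \notin D' by apply: contra wD; apply/fsubsetP.
have iBD : ind (B `|` star w D') by apply: ind_zero_ext; rewrite // cD' geq_minl.
have := @card_le_rk _ ind (Z `|` star w D) _ _ iBD; rewrite -cD' -(card_star w) => h.
apply: leq_trans (h _).
  rewrite cardfsU; have -> : B `&` star w D' = fset0; last by rewrite cardfs0 subn0.
  apply/fsetP => e; rewrite in_fsetI in_fset0; apply/negP => /andP[eB /in_star[x xD ee]].
  by case/negP: wB; apply/in_vsetP; exists e; rewrite // ee inc_mkedge eqxx.
apply: fsetUSS => //; apply/fsubsetP => e /in_star[x xD ->]; rewrite mem_star.
exact: (fsubsetP D'D).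
Qed.

Lemma ind_leaf B x z : ind B -> z \notin vset B -> x != z -> ind (mkedge x z |` B).
Proof.
move=> iB zB xz; rewrite fsetUC.
have -> : [fset mkedge x z] = star z [fset x].
  apply/fsetP => e; rewrite in_fset1; apply/eqP/in_star => [->|[y]].
    by exists x; rewrite ?in_fset1 // mkedgeC.
  by rewrite in_fset1 => /eqP-> ->; rewrite mkedgeC.
by apply: ind_zero_ext; rewrite ?cardfs1 // in_fset1 eq_sym.
Qed.

(** An edge split needs its extra neighbours to be vertices of the graph already, and a base may
    miss some. The missing ones are attached to [x] as leaves, which keeps independence because [d]
    is positive. *)
Lemma ind_cover B x (X : {fset nat}) : ind B -> x \in vset B ->
  exists B', [/\ B `<=` B', ind B', X `<=` vset B' & vset B' `<=` X `|` vset B].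
Proof.
move=> iB xB; have [n le_n] := ubnP #|` X|; elim: n X le_n => // n IH X le_n.
case: (fset_0Vmem X) => [->|[z zX]].
  by exists B; split; rewrite ?fsub0set // fset0U.
have [|B' [h1 h2 h3 h4]] := IH (X `\ z).
  by move: le_n; rewrite (cardfsD1 z X) zX.
case: (boolP (z \in vset B')) => zB'.
  exists B'; split=> //.
    by rewrite -(fsetD1K zX) fsubUset fsub1set zB'.
  by apply: (fsubset_trans h4); apply: fsetSU; apply: fsubD1set.
have xB' : x \in vset B' by apply: (fsubsetP (vset_sub h1)).
have xz : x != z by apply: contraNneq zB' => <-.
exists (mkedge x z |` B'); split.
- by apply: (fsubset_trans h1); apply: fsubsetU1.
- exact: ind_leaf.
- rewrite -(fsetD1K zX) vsetU fsubUset fsub1set; apply/andP; split.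
    rewrite in_fsetU; apply/orP; left; apply/in_vsetP; exists (mkedge x z).
      by rewrite in_fset1.
    by rewrite inc_mkedge eqxx orbT.
  by apply: (fsubset_trans h3); apply: fsubsetUr.
rewrite vsetU fsubUset; apply/andP; split.
  apply/fsubsetP => y /in_vsetP[e]; rewrite in_fset1 => /eqP ->.
  rewrite inc_mkedge in_fsetU => /orP[]/eqP ->; first by rewrite xB orbT.
  by rewrite zX.
by apply: (fsubset_trans h4); apply: fsetSU; apply: fsubD1set.
Qed.

Lemma ind_star w D : w \notin D -> ind (star w D).
Proof.
have [n le_n] := ubnP #|` D|; elim: n D le_n => // n IH D le_n wD.
case: (fset_0Vmem D) => [->|[z zD]]; first by rewrite (_ : star w fset0 = fset0) //;
  apply/fsetP => e; rewrite in_fset0; apply/in_star => -[].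
have zw : w != z by apply: contraNneq wD => ->.
have -> : star w D = mkedge w z |` star w (D `\ z).
  apply/fsetP => e; rewrite in_fset1U; apply/in_star/orP => [[x xD ->]|[/eqP->|/in_star[x]]].
  - case: (eqVneq x z) => [->|xz]; [by left|right].
    by rewrite mem_star in_fsetD1 xz.
  - by exists z.
  - by rewrite in_fsetD1 => /andP[_ xD] ->; exists x.
apply: ind_leaf => //.
  apply: IH; first by move: le_n; rewrite (cardfsD1 z D) zD.
  by rewrite in_fsetD1 negb_and wD orbT.
apply/negP => /in_vsetP[e /in_star[x]]; rewrite in_fsetD1 => /andP[xz _] ->.
by rewrite inc_mkedge (eq_sym z w) (eq_sym z x) (negbTE zw) (negbTE xz).
Qed.

Lemma nbr_le_rk G v : wf_graph G -> #|` nbr G v| <= rk G.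
Proof.
move=> wG; rewrite -(card_star v); apply: card_le_rk; last exact/ind_star/nbr_self.
by apply/fsubsetP => e /in_star[x]; rewrite in_nbr => h ->.
Qed.

Hypothesis hs : edge_split_preserves_indep M d.

(** If [Z] does not span [xy], a base of [Z] together with [xy] is independent; splitting [xy] by
    [w] trades that edge for the [d + 1] edges from [w] to [D]. *)
Lemma rk_one_ext Z w x y D : w \notin vset Z -> w \notin D -> x \in D -> y \in D -> x != y ->
  #|` D| = d.+1 -> rk Z < rk (mkedge x y |` Z) ->
  rk Z + d.+1 <= rk (Z `|` star w D).
Proof.
move=> wZ wD xD yD xy cD lt.
have [B [BZ iB cB]] := rk_base I0 Z; have [X [XZ iX cX]] := rk_base I0 (mkedge x y |` Z).
have [|e] := Iaug iB iX; first by rewrite cB cX.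
rewrite in_fsetD => /andP[eB eX] ieB.
(* [B] is already a base of [Z], so the augmenting edge can only be [xy]. *)
have {}eX : e = mkedge x y.
  have := fsubsetP XZ _ eX; rewrite in_fset1U => /orP[/eqP //|eZ].
  have : e |` B `<=` Z by rewrite fsubUset fsub1set eZ.
  by move/card_le_rk => /(_ _ ieB); rewrite cardfsU1 eB cB add1n ltnn.
subst e; set e := mkedge x y in eB ieB.
set X' := D `\ x `\ y.
have xV : x \in vset (e |` B).
  by apply/in_vsetP; exists e; rewrite ?in_fset1U ?eqxx // inc_mkedge eqxx.
have yV : y \in vset (e |` B).
  by apply/in_vsetP; exists e; rewrite ?in_fset1U ?eqxx // inc_mkedge eqxx orbT.
have [B' [h1 h2 h3 h4]] := @ind_cover (e |` B) x X' ieB xV.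
have wx : w != x by apply: contraNneq wD => ->.
have wy : w != y by apply: contraNneq wD => ->.
have wB' : w \notin vset B'.
  apply: contra (wD) => /(fsubsetP h4); rewrite in_fsetU => /orP[].
    by rewrite !in_fsetD1 => /and3P[].
  rewrite vsetU in_fsetU => /orP[/in_vsetP[f]|].
    by rewrite in_fset1 => /eqP->; rewrite inc_mkedge => /orP[]/eqP h; rewrite h in wx, wy *.
  by move/(fsubsetP (vset_sub BZ)) => h; rewrite h in wZ.
have wfB' := ind_wf h2.
have := hs (G := B') (u := x) (v := y) (w := w) (X := X') wfB'.
rewrite -vsetE => /(_ _ xy wB' h3) H.
have {H} : indep M (edge_split B' x y w X').
  apply: H; rewrite ?in_fsetD1 ?eqxx ?andbF //.
  - by apply: (fsubsetP h1); rewrite in_fset1U eqxx.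
  - have := cardfsD1 x D; have := cardfsD1 y (D `\ x).
    rewrite xD in_fsetD1 yD eq_sym xy cD /X' => /= c2 c1.
    by move: c1; rewrite c2 !add1n => -[->].
  - exact/(indepE hM).
(* The split removes only [xy], which is not in [B]; the auxiliary leaves are dropped by passing to
   this subset. *)
have sub : B `|` star w D `<=` edge_split B' x y w X'.
  rewrite /edge_split; apply: fsetUSS.
    rewrite -/e; apply/fsubsetP => f fB; rewrite in_fsetD1; apply/andP; split.
      by apply: contraNneq eB => <-.
    by apply: (fsubsetP h1); rewrite in_fset1U fB orbT.
  apply/fsubsetP => f /in_star[z zD ->]; apply/imfsetP; exists z => //=.
  rewrite !in_fset1U !in_fsetD1 zD; by case: (z == x); case: (z == y).
have wD' : wf_graph (edge_split B' x y w X').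
  apply: wfU; first by apply: wf_sub wfB'; apply: fsubD1set.
  apply: wf_star; rewrite !in_fset1U !in_fsetD1 !negb_or wx wy /=.
  by rewrite (negbTE wD) ?andbF.
move/(indepE hM wD') => /Isub/(_ sub) iBD.
have := @card_le_rk _ ind (Z `|` star w D) _ _ iBD => /(_ (fsetSU _ BZ)).
apply: leq_trans; rewrite -cD -cB -(card_star w) cardfsU.
have -> : B `&` star w D = fset0; last by rewrite cardfs0 subn0.
apply/fsetP => f; rewrite in_fsetI in_fset0; apply/negP => /andP[fB /in_star[z zD ee]].
case/negP: wZ; apply: (fsubsetP (vset_sub BZ)); apply/in_vsetP; exists f; rewrite // ee.
by rewrite inc_mkedge eqxx.
Qed.

End Extensions.

(** * Ranks of complete graphs *)

Lemma complete_add w S : w \notin S -> complete (w |` S) = complete S `|` star w S.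
Proof.
move=> wS; apply/fsetP => e; rewrite in_fsetU.
apply/idP/orP => [eC|[|/in_star[x xS ->]]].
- have we := wf_complete eC; rewrite -(mkedgeE we) in eC *.
  move: eC; rewrite !mkedge_complete !in_fset1U => /and3P[].
  case/orP => [/eqP e1|e1] /orP[/eqP e2|e2] ne.
  + by rewrite e1 e2 eqxx in ne.
  + by right; rewrite e1 mem_star.
  + by right; rewrite e2 mkedgeC mem_star.
  + by left; rewrite e1 e2.
- exact/fsubsetP/complete_sub/fsubsetU1.
- rewrite mkedge_complete !in_fset1U eqxx xS orbT /=.
  by apply: contraNneq wS => ->.
Qed.

(** When [q] vertices are added one by one, each joined to all earlier ones, only the first [d] of
    them can gain less than [d], so the total deficit is at most [d * d]. *)
Lemma sum_minn_ge d q : d * q <= \sum_(i < q) minn d i + d * d.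
Proof.
suff : d * q <= \sum_(i < q) minn d i + d * minn q d.
  by move=> h; apply: leq_trans h _; rewrite leq_add2l leq_mul2l geq_minr orbT.
elim: q => [|q IH]; first by rewrite muln0.
rewrite big_ord_recr /=; rewrite mulnS; move: (\sum_(i < q) _) IH => s IH; case: (leqP d q) => h.
  by move: IH; rewrite (minn_idPr h) (minn_idPr (leqW h)); lia.
by move: IH; rewrite (minn_idPl h) (minn_idPl (ltnW h)) mulnS; lia.
Qed.

Section Cliques.
Variable M : graph -> {fset edge} -> bool.
Hypothesis hM : graph_matroid_family M.
Variable d : nat.
Hypothesis hd : dimensionality M d.

Notation ind := (ind M).
Notation rk := (mrank ind).
Let I0 := ind0 hM.
Let Isub := @ind_sub M hM.
Let Iaug := @ind_aug M hM.

Definition kr n := rk (K_n n).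

(** Numbering the vertices by their position in the enumeration of [S] is an isomorphism onto
    [K_n]. *)
Lemma rk_complete S : rk (complete S) = kr #|` S|.
Proof.
pose phi x := index x (S : seq nat).
have vS : vset (complete S) `<=` S by rewrite -sub_complete //; apply: wf_complete.
have inj : {in S &, injective phi}.
  by move=> x y xS yS e; rewrite -(nth_index 0 xS) -(nth_index 0 yS) -!/(phi _) e.
have inj' : {in vset (complete S) &, injective phi}.
  by move=> x y /(fsubsetP vS) xS /(fsubsetP vS) yS; apply: inj.
rewrite -(rk_emap hM (@wf_complete S) inj') /kr; congr (mrank _ _).
have phiS x : x \in S -> phi x < #|` S| by rewrite -index_mem.
have inK i : (i \in [fset i | i in iota 0 #|` S|]) = (i < #|` S|).
  by rewrite in_fset mem_iota.
apply/fsetP => e; apply/imfsetP/idP => /= [[f fC ->]|].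
  have wf := wf_complete fC; rewrite -(mkedgeE wf) in fC *.
  move: fC; rewrite emap_mkedge !mkedge_complete !inK => /and3P[h1 h2 h3].
  rewrite !phiS //=; apply: contra h3 => /eqP h; apply/eqP; exact: inj.
move=> eK; have we := wf_complete eK; rewrite -(mkedgeE we) in eK *.
move: eK; rewrite mkedge_complete !inK => /and3P[h1 h2 h3].
have nS i : i < #|` S| -> nth 0 (S : seq nat) i \in S by move=> h; apply: mem_nth.
have pn i : i < #|` S| -> phi (nth 0 (S : seq nat) i) = i.
  by move=> h; apply: index_uniq; rewrite ?fset_uniq.
exists (mkedge (nth 0 (S : seq nat) e.1) (nth 0 (S : seq nat) e.2)).
  rewrite mkedge_complete !nS //=; apply: contra h3 => /eqP h.
  by rewrite -(pn _ h1) h pn.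
by rewrite emap_mkedge !pn.
Qed.

Lemma rk_le_kr G S : wf_graph G -> vset G `<=` S -> rk G <= kr #|` S|.
Proof. by move=> wG; rewrite -sub_complete // -rk_complete; apply: rk_mono. Qed.

Lemma kr_mono m n : m <= n -> kr m <= kr n.
Proof.
move=> mn; apply: rk_mono => //; apply: complete_sub; apply/fsubsetP => i.
by rewrite !in_fset !mem_iota /= => /leq_trans; apply.
Qed.

Lemma card_iota n : #|` [fset i | i in iota 0 n]| = n.
Proof. by rewrite card_fseq undup_id ?iota_uniq // size_iota. Qed.

Lemma kr_succ_ge n : kr n + minn d n <= kr n.+1.
Proof.
set S := [fset i | i in iota 0 n].
have nS : n \notin S by rewrite in_fset mem_iota add0n ltnn.
have := rk_complete (n |` S); rewrite cardfsU1 nS card_iota => <-.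
rewrite complete_add // -{2}(card_iota n); apply: rk_zero_ext => //.
apply: contra nS; apply/fsubsetP; rewrite -sub_complete //; exact: wf_complete.
Qed.

(** The lower bound is a 0-extension. For the upper bound, a circuit [C] with a vertex [v] of degree
    [d + 1] shows that [d] edges at a new vertex span all its other edges to a large clique. *)
Lemma kr_succ : exists N, forall n, N <= n -> kr n.+1 = kr n + d.
Proof.
case: hd => [[C [[wC [dC hC]] [[v vC degv] _]]] _].
rewrite -vsetE in vC; rewrite deg_nbr // in degv.
(* This leaves room for a set [D] of [d] vertices and for a copy of [C]. *)
exists (maxn d.+1 #|` vset C|) => n; rewrite geq_max => /andP[dn Cn].
set S := [fset i | i in iota 0 n].
have cS : #|` S| = n by apply: card_iota.
have nS : n \notin S by rewrite in_fset mem_iota add0n ltnn.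
apply/eqP; rewrite eqn_leq; apply/andP; split; last first.
  by have := kr_succ_ge n; rewrite (minn_idPl (ltnW dn)).
have := rk_complete (n |` S); rewrite cardfsU1 nS cS => <-.
rewrite complete_add //.
have <- : rk (complete S) = kr n by rewrite rk_complete cS.
have [|D DS cD] := @subfset_of_card _ S d; first by rewrite cS ltnW.
set J := complete S `|` star n D.
have JS : J `<=` complete S `|` star n S.
  apply: fsetUS; apply/fsubsetP => e /in_star[x xD ->]; rewrite mem_star.
  exact: (fsubsetP DS).
(* Once [J] spans, subadditivity bounds the gain by the [d] edges from [n] to [D]. *)
suff sp : forall e, e \in complete S `|` star n S -> rk (e |` J) = rk J.
  rewrite (rk_span I0 Iaug JS sp) -cD -(card_star n).
  by apply: leq_trans (rk_subadd I0 Isub Iaug _ _) _; rewrite leq_add2l rk_card.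
move=> e; rewrite in_fsetU => /orP[eS|/in_star[x xS ->]].
  by rewrite (fsetUidPr _ _ _) // fsub1set in_fsetU eS.
case: (boolP (x \in D)) => xD.
  by rewrite (fsetUidPr _ _ _) // fsub1set in_fsetU mem_star xD orbT.
(* A copy of [C] in which [v] becomes [n], one neighbour of [v] becomes [x]
   and the other neighbours become [D] has [nx] as its only edge outside [J]. *)
pose sC := v :: (nbr C v : seq nat) ++ (vset C `\` (v |` nbr C v) : seq nat).
pose sS := n :: rcons (D : seq nat) x ++ (S `\` (x |` D) : seq nat).
pose phi y := nth 0 sS (index y sC).
have vN : v \notin nbr C v by apply: nbr_self.
have uC : uniq sC.
  rewrite /= cat_uniq mem_cat negb_or !fset_uniq vN /= andbT.
  rewrite in_fsetD in_fset1U eqxx /=; apply/hasPn => y.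
  by rewrite in_fsetD in_fset1U negb_or => /andP[/andP[]].
have mC y : (y \in sC) = (y \in vset C).
  rewrite in_cons mem_cat in_fsetD in_fset1U negb_or.
  case: (eqVneq y v) => [->|_] //=.
  case h : (y \in nbr C v) => //=.
  by rewrite (fsubsetP (nbr_vset _ _) _ h).
have uS : uniq sS.
  rewrite /= cat_uniq mem_cat mem_rcons in_cons !negb_or rcons_uniq !fset_uniq xD /= andbT.
  have -> : n != x by apply: contraNneq nS => ->.
  have -> : n \notin D by apply: contra nS; apply/fsubsetP.
  rewrite in_fsetD (negbTE nS) andbF /=; apply/hasPn => y.
  by rewrite in_fsetD in_fset1U negb_or mem_rcons in_cons negb_or => /andP[].
have mS y : (y \in sS) -> y \in n |` S.
  rewrite in_cons mem_cat mem_rcons in_cons in_fsetD !in_fset1U.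
  case/or3P => [->//|/orP[/eqP->|/(fsubsetP DS) ->]|/andP[_ ->]]; by rewrite ?xS orbT.
have sz : size sC <= size sS.
  apply: (@leq_trans #|` vset C|); first by apply: uniq_leq_size => // y; rewrite mC.
  apply: (leq_trans Cn); rewrite -cS; apply: uniq_leq_size; first exact: fset_uniq.
  move=> y yS; rewrite in_cons mem_cat mem_rcons in_cons in_fsetD in_fset1U yS.
  by case: (y == x); case: (y \in D); rewrite ?orbT.
have inj : {in vset C &, injective phi}.
  move=> y z; rewrite -!mC => yC zC /eqP; rewrite nth_uniq //.
  - by move/eqP => h; rewrite -(nth_index 0 yC) h nth_index.
  - by apply: leq_trans sz; rewrite index_mem.
  - by apply: leq_trans sz; rewrite index_mem.
have phiv : phi v = n by rewrite /phi /= eqxx.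
have phiN y : y \in nbr C v -> phi y = nth 0 (rcons (D : seq nat) x) (index y (nbr C v : seq nat)).
  move=> yN; rewrite /phi /=; case: eqP => [h|_]; first by rewrite -h (negbTE vN) in yN.
  rewrite index_cat yN /= nth_cat size_rcons -[size (D : seq nat)]/(#|` D|) cD -degv.
  by rewrite index_mem yN.
have szN : size (nbr C v : seq nat) = d.+1 by exact: degv.
(* [rcons] places [x] at index [d] after [D], so the last of the [d + 1] neighbours of [v] is sent
   to [x]. *)
have [u uN phiu] : exists2 u, u \in nbr C v & phi u = x.
  exists (nth 0 (nbr C v : seq nat) d); first by apply: mem_nth; rewrite szN.
  rewrite phiN; last by apply: mem_nth; rewrite szN.
  by rewrite index_uniq ?fset_uniq ?szN // nth_rcons -[size (D : seq nat)]/(#|` D|) cD ltnn eqxx.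
set e0 := mkedge n x; set C' := [fset emap phi f | f in C].
have fC : mkedge v u \in C by rewrite -in_nbr.
have emf : emap phi (mkedge v u) = e0 by rewrite emap_mkedge phiv phiu.
have eC' : e0 \in C' by rewrite -emf; apply: in_imfset.
have C'J : C' `\ e0 `<=` J.
  apply/fsubsetP => y; rewrite in_fsetD1 => /andP[ye /imfsetP[g /= gC yg]].
  have wg := wC _ gC.
  case: (boolP (inc v g)) => [/(inc_wf_edge wg)[z zv gz]|ig].
    have zN : z \in nbr C v by rewrite in_nbr -gz.
    move: ye; rewrite yg gz emap_mkedge phiv /e0 => ye.
    rewrite in_fsetU mem_star; apply/orP; right.
    have : phi z \in rcons (D : seq nat) x.
      by rewrite phiN //; apply: mem_nth; rewrite size_rcons -[size (D : seq nat)]/(#|` D|) cD -szN index_mem.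
    rewrite mem_rcons in_cons => /orP[/eqP h|//].
    by rewrite h eqxx in ye.
  have gV a : inc a g -> (a \in vset C) && (a != v).
    move=> ia; apply/andP; split; first by apply/in_vsetP; exists g.
    by apply: contraNneq ig => <-.
  have pS a : (a \in vset C) && (a != v) -> phi a \in S.
    case/andP=> aC av; have : phi a \in sS.
      by apply: mem_nth; apply: leq_trans sz; rewrite index_mem mC.
    move/mS; rewrite in_fset1U => /orP[/eqP h|//].
    by move: av; rewrite (inj a v) ?eqxx // phiv.
  have g1 : inc g.1 g by rewrite /inc eqxx.
  have g2 : inc g.2 g by rewrite /inc eqxx orbT.
  rewrite in_fsetU yg /emap mkedge_complete !pS ?gV //=.
  apply/orP; left; apply/eqP => h.
  by move: wg; rewrite (inj _ _ _ _ h) ?ltnn //; [case/andP: (gV _ g1)|case/andP: (gV _ g2)].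
have iC' : ind (C' `\ e0).
  have h1 : ind (C `\ mkedge v u).
    by apply/(indepE hM); [apply: wf_sub wC; apply: fsubD1set|apply: hC].
  rewrite (ind_emap hM wC inj (fsubD1set _ _)) in h1; apply: Isub h1 _.
  apply/fsubsetP => y; rewrite in_fsetD1 => /andP[ye /imfsetP[g /= gC yg]].
  apply/imfsetP; exists g => //=; rewrite in_fsetD1 gC andbT.
  by apply: contraNneq ye => h; rewrite yg h emf.
(* [C'] is dependent, so [e0] is spanned by the rest of [C'], and therefore by the larger set
   [J]. *)
have dC' : rk C' <= #|` C' `\ e0|.
  have := cardfsD1 e0 C'; rewrite eC' add1n => c; rewrite -ltnS -c ltnNge.
  apply/negP => /(indep_rk I0) h; case: dC; apply/(indepE hM) => //.
  by rewrite (ind_emap hM wC inj (fsubset_refl _)).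
apply/eqP; rewrite eqn_leq (rk_mono I0 (fsubsetU1 _ _)) andbT.
have := rk_connectivity_mono I0 Isub Iaug [fset e0] C'J.
rewrite (fsetUC _ [fset e0]) (fsetUC _ [fset e0]) fsetD1K // (rk_indep I0 iC') => h.
by rewrite -(leq_add2l #|` C' `\ e0|); apply: leq_trans h _; rewrite addnC leq_add2r.
Qed.

Lemma kr_bound : exists b, forall n, kr n <= d * n + b.
Proof.
have [N hN] := kr_succ; exists (kr N) => n.
case: (leqP n N) => h; first by apply: leq_trans (kr_mono h) (leq_addl _ _).
rewrite -(subnKC (ltnW h)); elim: (n - N) => [|k IH]; first by rewrite addn0 leq_addl.
by rewrite addnS hN ?leq_addr //; move: IH; rewrite mulnS; lia.
Qed.

(** The vertices of [Q] are added one at a time by 0-extensions to the earlier ones; [sum_minn_ge]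
    bounds the deficit. *)
Lemma rk_add_clique Z Q : [disjoint vset Z & Q]%fset ->
  rk Z + d * #|` Q| <= rk (Z `|` complete Q) + d * d.
Proof.
move=> dis.
suff h : rk Z + \sum_(i < #|` Q|) minn d i <= rk (Z `|` complete Q).
  by have := sum_minn_ge d #|` Q|; lia.
have [n le_n] := ubnP #|` Q|; elim: n Q dis le_n => // n IH Q dis le_n.
case: (fset_0Vmem Q) => [->|[w wQ]].
  by rewrite cardfs0 big_ord0 addn0; apply: rk_mono => //; apply: fsubsetUl.
have cQ := cardfsD1 w Q; rewrite wQ add1n in cQ.
have wQ' : w \notin Q `\ w by rewrite in_fsetD1 eqxx.
have sub := fsubD1set Q w.
have /IH : [disjoint vset Z & Q `\ w]%fset by apply: fdisjointWr dis.
rewrite cQ big_ord_recr /= addnA => /(_ _) h.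
rewrite -[complete Q](congr1 complete (fsetD1K wQ)) complete_add // fsetUA.
have wZ : w \notin vset (Z `|` complete (Q `\ w)).
  rewrite vsetU in_fsetU negb_or; apply/andP; split.
    by apply/negP => wZ; move/fdisjointP: dis => /(_ _ wZ); rewrite wQ.
  apply: contra wQ'; apply/fsubsetP; rewrite -sub_complete //; exact: wf_complete.
apply: leq_trans (rk_zero_ext hM hd wZ wQ'); rewrite leq_add2r; apply: h.
by rewrite cQ in le_n.
Qed.

End Cliques.

(** * Averaging over vertex orderings *)

Lemma sum_mem_fset (T : choiceType) (A B : {fset T}) :
  \sum_(u <- A) (u \in B) = #|` A `&` B|.
Proof.
transitivity (\sum_(u <- A | u \in B) 1).
  by rewrite [RHS]big_mkcond; apply: eq_bigr => u _; case: (u \in B).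
rewrite big_fset_condE /= sum1_size; congr size; congr enum_fset.
by apply/fsetP => u; rewrite !inE.
Qed.

Section Potential.
Import Order.TTheory GRing.Theory Num.Theory.
Local Open Scope ring_scope.
(** In the application [f S] is the rank of the subgraph induced on [S], [N v] is the neighbourhood
    of [v], and [x v], [y v] are two unlinked neighbours. Then [hf] bounds from below the rank
    gained when [v] is added last to [S]. *)
Variables (d : nat) (f : {fset nat} -> nat) (N : nat -> {fset nat}) (x y : nat -> nat).
Variable V : {fset nat}.
Hypothesis hN : forall v, v \in V -> v \notin N v.
Hypothesis hf : forall S v, S `<=` V -> v \in S ->
  (f (S `\ v) + d + ((x v \in S) && (y v \in S)) <= f S + (d.+1 - #|` N v `&` S|))%N.

(** Subtraction is truncated: a vertex with [j] earlier neighbours loses [d + 1 - j] if this is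
    positive and nothing otherwise. *)
Definition lossum (a : nat) : nat := (\sum_(j < a.+1) (d.+1 - j))%N.

Lemma lossum_le a : (lossum a <= d.+1 * d.+1)%N.
Proof.
suff h m : (\sum_(j < m) (d.+1 - j) <= d.+1 * minn m d.+1)%N.
  by apply: leq_trans (h _) _; rewrite leq_mul2l geq_minr orbT.
elim: m => [|m IH]; first by rewrite big_ord0.
rewrite big_ord_recr /=; move: (\sum_(j < m) _)%N IH => s IH.
case: (leqP m.+1 d.+1) => h.
  by move: IH; rewrite (minn_idPl (ltnW h)) mulnS; lia.
by move: IH; rewrite (minn_idPr _); lia.
Qed.

(* Expected loss of a vertex with [a] neighbours in a random ordering: its
   number of earlier neighbours is uniform on [0..a]. *)
Definition loss (a : nat) : rat := (lossum a)%:R / a.+1%:R.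

(** Among a vertex and its [a] neighbours, the vertex comes last with probability 1/(a+1); otherwise
    the last neighbour can be discarded. For [a = 0] the term with [a.-1] has factor zero. *)
Lemma loss_rec a : a.+1%:R * loss a = a%:R * loss a.-1 + (d.+1 - a)%:R.
Proof.
rewrite /loss mulrC divfK ?pnatr_eq0 //; case: a => [|a] /=.
  by rewrite mul0r add0r /lossum big_ord1.
rewrite mulrC divfK ?pnatr_eq0 // -natrD; congr (_%:R).
by rewrite {1}/lossum big_ord_recr.
Qed.

(** When [v], [x v] and [y v] are distinct members of [S], the vertex [v] comes last of the three
    with probability 1/3, which is the weight of [both] in [contrib]. *)
Definition both v (S : {fset nat}) : bool := (x v \in S) && (y v \in S).

(* Lower bound for the expected rank contribution of [v] in a random ordering of [S]. *)
Definition contrib v (S : {fset nat}) : rat :=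
  d%:R - loss #|` N v `&` S| + (both v S)%:R / 3%:R.

(** A form linear in the indicators of [u], ready to be summed over [u]. The loss term is exact; the
    pair term may only be underestimated. *)
Lemma contrib_del v S u : v \in V -> u \in S ->
  d%:R - (loss #|` N v `&` S| + (u \in N v)%:R * (loss #|` N v `&` S|.-1 - loss #|` N v `&` S|))
   + (both v S)%:R / 3%:R * (1 - (u \in [fset x v])%:R - (u \in [fset y v])%:R)
  <= contrib v (S `\ u).
Proof.
move=> vV uS; rewrite /contrib !in_fset1.
have -> : #|` N v `&` (S `\ u)| = (#|` N v `&` S| - (u \in N v))%N.
  have := cardfsD1 u (N v `&` S); rewrite in_fsetI uS andbT -fsetIDA => ->.
  by rewrite addKn.
have hb : (both v S)%:R * (1 - (u == x v)%:R - (u == y v)%:R) <= (both v (S `\ u))%:R :> rat.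
  rewrite /both !in_fsetD1 ![_ == u]eq_sym.
  by case: (x v \in S); case: (y v \in S); case: (u == x v); case: (u == y v); rewrite //=; lra.
case: (u \in N v); rewrite ?subn1 ?subn0 ?mul1r ?mul0r ?addr0; lra.
Qed.

(** Condition on the last vertex of the ordering: either some [u] other than [v], or [v] itself,
    which then collects its gain. The loss terms balance by [loss_rec]; the pair terms do because
    each of [x v], [y v] is met at most once. *)
Lemma contrib_avg v S : S `<=` V -> v \in S ->
  #|` S|%:R * contrib v S <=
  \sum_(u <- S `\ v) contrib v (S `\ u) + (d%:R + (both v S)%:R - (d.+1 - #|` N v `&` S|)%:R).
Proof.
move=> SV vS; have vV := fsubsetP SV _ vS.
set a := #|` N v `&` S|.
have cS : #|` S|%:R = 1 + #|` S `\ v|%:R :> rat by rewrite (cardfsD1 v S) vS natrD.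
have sM (B : {fset nat}) : \sum_(u <- S `\ v) (u \in B)%:R = #|` (S `\ v) `&` B|%:R :> rat.
  by rewrite -sum_mem_fset natr_sum.
have sN : #|` (S `\ v) `&` N v| = a.
  rewrite /a; congr #|` _|; apply/fsetP => u; rewrite !in_fsetI in_fsetD1 andbC.
  by case: (eqVneq u v) => [->|//]; rewrite (negbTE (hN vV)).
have s1 z : #|` (S `\ v) `&` [fset z]|%:R <= 1 :> rat.
  by rewrite lern1 -(cardfs1 z); apply: fsubset_leq_card; apply: fsubsetIr.
have h : \sum_(u <- S `\ v) (d%:R - (loss a + (u \in N v)%:R * (loss a.-1 - loss a))
   + (both v S)%:R / 3%:R * (1 - (u \in [fset x v])%:R - (u \in [fset y v])%:R))
   <= \sum_(u <- S `\ v) contrib v (S `\ u).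
  rewrite big_seq [X in _ <= X]big_seq; apply: ler_sum => u.
  by rewrite in_fsetD1 => /andP[_ uS]; apply: contrib_del.
rewrite -lerBlDr; apply: le_trans h.
have e := loss_rec a; rewrite -natr1 in e; rewrite cS /contrib -/a.
move: (loss a) (loss a.-1) e => la lb e.
rewrite big_split /= sumrB big_split /= -mulr_suml -mulr_sumr !sumrB !sM sN.
have cst (k : rat) : \sum_(u <- S `\ v) k = k * #|` S `\ v|%:R.
  by rewrite big_const_seq count_predT iter_addr_0 mulr_natr.
rewrite !cst; move: (s1 (x v)) (s1 (y v)) e.
move: (#|` S `\ v|%:R) (#|` _|%:R) (#|` _|%:R) (a%:R) ((d.+1 - a)%:R) => s p q A t p1 q1 e.
by case: (both v S); rewrite /= ?mul0r ?mul1r; nra.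
Qed.

Lemma potential_le S : S `<=` V -> \sum_(v <- S) contrib v S <= (f S)%:R.
Proof.
have [n le_n] := ubnP #|` S|; elim: n S le_n => // n IH S le_n SV.
case: (fset_0Vmem S) => [->|[w wS]]; first by rewrite big_nil ler0n.
have n_gt0 : 0 < #|` S|%:R :> rat by rewrite ltr0n cardfs_gt0; apply/fset0Pn; exists w.
rewrite -(ler_pM2l n_gt0) mulr_sumr.
pose g v : rat := d%:R + (both v S)%:R - (d.+1 - #|` N v `&` S|)%:R.
apply: (@le_trans _ _ (\sum_(v <- S) (\sum_(u <- S `\ v) contrib v (S `\ u) + g v))).
  by rewrite big_seq [X in _ <= X]big_seq; apply: ler_sum => v vS; apply: contrib_avg.
(* Exchanging the sums groups the terms by the last vertex [u], where [hf] and the induction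
   hypothesis apply. *)
have -> : \sum_(v <- S) (\sum_(u <- S `\ v) contrib v (S `\ u) + g v) =
          \sum_(u <- S) (\sum_(v <- S `\ u) contrib v (S `\ u) + g u).
  rewrite !big_split /=; congr (_ + _).
  have sD (F : nat -> rat) v : \sum_(u <- S `\ v) F u = \sum_(u <- S | u != v) F u.
    rewrite [RHS]big_fset_condE /=; apply: eq_fbigl => u.
    by rewrite !inE andbC.
  under eq_bigr do rewrite sD.
  under [RHS]eq_bigr do rewrite sD.
  rewrite (exchange_big_dep xpredT) //=; apply: eq_bigr => u _; apply: eq_bigl => v.
  by rewrite eq_sym.
apply: (@le_trans _ _ (\sum_(u <- S) (f S)%:R)); last first.
  by rewrite big_const_seq count_predT iter_addr_0 mulr_natl.
rewrite big_seq [X in _ <= X]big_seq; apply: ler_sum => u uS.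
have := hf SV uS; rewrite -(ler_nat rat) !natrD -/(both u S) => h.
have : \sum_(v <- S `\ u) contrib v (S `\ u) <= (f (S `\ u))%:R.
  apply: IH; last by apply: fsubset_trans SV; apply: fsubD1set.
  by move: le_n; rewrite (cardfsD1 u S) uS.
rewrite /g; lra.
Qed.

(** Each loss is at most 1/12 by the choice of [c], and 1/3 - 1/12 = 1/4; the inequality is
    multiplied by 4 to stay in [nat]. *)
Lemma potential_bound c :
  (forall v, v \in V -> [/\ x v \in V, y v \in V & (c <= #|` N v `&` V|)%N]) ->
  (12 * (d.+1 * d.+1) <= c)%N ->
  ((4 * d + 1) * #|` V| <= 4 * f V)%N.
Proof.
move=> hV hc; have := potential_le (fsubset_refl V).
have h : \sum_(v <- V) (d%:R + 4%:R^-1) <= \sum_(v <- V) contrib v V.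
  rewrite big_seq [X in _ <= X]big_seq; apply: ler_sum => v vV.
  have [xV yV ca] := hV _ vV; rewrite /contrib /both xV yV /=.
  suff : loss #|` N v `&` V| <= 12%:R^-1 by lra.
  move: ca; set a := #|` _| => ca.
  rewrite /loss ler_pdivrMr ?ltr0n // mulrC ler_pdivlMr ?ltr0n // -natrM ler_nat.
  by have := lossum_le a; lia.
move/(le_trans h); rewrite big_const_seq count_predT iter_addr_0 -/(#|` V|) -mulr_natr => {}h.
have : ((4 * d + 1) * #|` V|)%:R <= (4 * f V)%:R :> rat.
  by rewrite !natrM natrD natrM; nra.
by rewrite ler_nat.
Qed.

End Potential.

(** * The Lovasz-Yemini property *)

(* Vertex cuts instead of paths: deleting a simplicial vertex then needs no
   rerouting. *)
Definition cutconn (c : nat) (G : graph) : Prop :=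
  c < #|` vset G| /\
  forall A B, A `<=` vset G -> B `<=` vset G -> [disjoint A & B]%fset ->
    A != fset0 -> B != fset0 -> #|` vset G `\` (A `|` B)| < c ->
    exists a b, [/\ a \in A, b \in B & mkedge a b \in G].

(** A path from [A] to [B] that avoids all other vertices has a step from [A] into [B]. *)
Lemma k_connected_cut c G : k_connected c G -> cutconn c G.
Proof.
case; rewrite -vsetE => cV hp; split=> // A B AV BV dis /fset0Pn[a aA] /fset0Pn[b bB] cX.
set X := vset G `\` (A `|` B) in cX.
have nX z : z \in A `|` B -> z \in vset G `\` X.
  move=> zAB; rewrite in_fsetD in_fsetD zAB /=.
  by move: zAB; rewrite in_fsetU => /orP[/(fsubsetP AV)|/(fsubsetP BV)].
have [||p /andP[]] := hp X (fsubsetDl _ _) cX a b.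
- by apply: nX; rewrite in_fsetU aA.
- by apply: nX; rewrite in_fsetU bB orbT.
elim: p a aA => [|z p IH] a aA /=.
  by move=> _ /eqP ab; move/fdisjointP: dis => /(_ _ aA); rewrite ab bB.
case/andP=> /and3P[_ zX az] pp lst.
have : z \in A `|` B.
  apply/negPn; apply: contra zX => zAB; rewrite in_fsetD zAB.
  by have /andP[] := vset_edge az.
rewrite in_fsetU => /orP[zA|zB]; first exact: (IH z).
by exists a, z.
Qed.

Lemma cut_mono c c' G : c' <= c -> cutconn c G -> cutconn c' G.
Proof.
move=> cc [h1 h2]; split; first exact: leq_ltn_trans h1.
by move=> A B AV BV dis A0 B0 h; apply: h2 => //; apply: leq_trans h cc.
Qed.

(** Otherwise the neighbourhood of [v] is a small cut between [v] and its non-neighbours. *)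
Lemma cut_deg c G v : wf_graph G -> cutconn c G -> v \in vset G -> c <= #|` nbr G v|.
Proof.
move=> wG [cV h] vG; rewrite leqNgt; apply/negP => lt.
set B := vset G `\` (v |` nbr G v).
have vN := nbr_self v wG.
have NV : v |` nbr G v `<=` vset G by rewrite fsubUset fsub1set vG nbr_vset.
have vB : [disjoint [fset v] & B]%fset.
  by rewrite fdisjoint1X in_fsetD in_fset1U eqxx.
have [||||a [b [/fset1P -> ]]] := h [fset v] B _ (fsubsetDl _ _) vB.
- by rewrite fsub1set.
- by apply/fset0Pn; exists v; rewrite in_fset1.
- rewrite -cardfs_gt0 cardfsDS // subn_gt0 cardfsU1 vN add1n.
  by apply: leq_ltn_trans cV.
- apply: leq_ltn_trans lt; apply: fsubset_leq_card; apply/fsubsetP => z.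
  rewrite !in_fsetD in_fsetU in_fset1 in_fsetD in_fset1U.
  by case: (z == v) => //=; case: (z \in nbr G v); case: (z \in vset G).
by rewrite in_fsetD in_fset1U in_nbr => /andP[/negP hn _] e; apply: hn; rewrite e orbT.
Qed.

Definition delv (v : nat) (G : graph) : graph := induced (vset G `\ v) G.

Lemma vset_delv c G v : 1 < c -> wf_graph G -> cutconn c G -> vset (delv v G) = vset G `\ v.
Proof.
move=> c1 wG hG; apply/eqP; rewrite eqEfsubset vset_induced /=.
apply/fsubsetP => z; rewrite in_fsetD1 => /andP[zv zG].
have /fset0Pn[y] : nbr G z `\ v != fset0.
  rewrite -cardfs_gt0; have := leq_trans c1 (cut_deg wG hG zG).
  by rewrite (cardfsD1 v); case: (v \in _) => /=; lia.
rewrite in_fsetD1 in_nbr => /andP[yv zy].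
have h : mkedge z y \in delv v G.
  by rewrite mkedge_induced zy !in_fsetD1 zv yv zG; have /andP[] := vset_edge zy.
by have /andP[] := vset_edge h.
Qed.

Lemma wf_delv v G : wf_graph G -> wf_graph (delv v G).
Proof. apply: wf_sub; exact: induced_sub. Qed.

Lemma delv_edge v G a b : a != v -> b != v -> mkedge a b \in G -> mkedge a b \in delv v G.
Proof.
by move=> av bv h; have /andP[aG bG] := vset_edge h; rewrite mkedge_induced h !in_fsetD1 av bv aG bG.
Qed.

Lemma cut_delv c G v : 0 < c -> wf_graph G -> cutconn c.+1 G -> v \in vset G ->
  cutconn c (delv v G).
Proof.
move=> c0 wG hG vG; have vE := @vset_delv c.+1 G v c0 wG hG.
case: hG => cV h; split; rewrite vE.
  by move: cV; rewrite (cardfsD1 v) vG.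
move=> A B AV BV dis A0 B0 hc.
have nv (S : {fset nat}) z : S `<=` vset G `\ v -> z \in S -> (z != v) && (z \in vset G).
  by move=> SV /(fsubsetP SV); rewrite in_fsetD1.
have sV (S : {fset nat}) : S `<=` vset G `\ v -> S `<=` vset G.
  by move=> SV; apply: (fsubset_trans SV); apply: fsubD1set.
have [|a [b [aA bB ab]]] := h A B (sV _ AV) (sV _ BV) dis A0 B0.
  apply: leq_ltn_trans (_ : #|` v |` ((vset G `\ v) `\` (A `|` B))| < _).
    apply: fsubset_leq_card; apply/fsubsetP => z.
    rewrite in_fset1U !in_fsetD in_fset1; by case: (z == v).
  by rewrite cardfsU1; case: (v \notin _) => /=; rewrite ?add1n ?add0n ltnS // ltnW.
exists a, b; split=> //; apply: delv_edge => //.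
  by have /andP[] := nv _ _ AV aA.
by have /andP[] := nv _ _ BV bB.
Qed.

(** If both sides meet the clique of neighbours of [v], an edge of the clique joins them. Otherwise
    one side avoids it, and [v] can be added to the other side without creating an edge between the
    sides. *)
Lemma cut_delv_simplicial c G v : 1 < c -> wf_graph G -> cutconn c G -> v \in vset G ->
  c.+1 < #|` vset G| ->
  {in nbr G v &, forall x y, x != y -> mkedge x y \in G} ->
  cutconn c (delv v G).
Proof.
move=> c1 wG hG vG cV sim; have vE := @vset_delv c G v c1 wG hG.
split; rewrite vE; first by move: cV; rewrite (cardfsD1 v) vG.
suff H A B : A `<=` vset G `\ v -> B `<=` vset G `\ v -> [disjoint A & B]%fset ->
    A != fset0 -> B != fset0 -> #|` (vset G `\ v) `\` (A `|` B)| < c ->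
    [disjoint A & nbr G v]%fset ->
    exists a b, [/\ a \in A, b \in B & mkedge a b \in delv v G].
  move=> A B AV BV dis A0 B0 hc.
  case: (boolP [disjoint A & nbr G v]%fset) => dA; first exact: H.
  case: (boolP [disjoint B & nbr G v]%fset) => dB.
    have [||a [b [aB bA ab]]] := H B A BV AV _ B0 A0 _ dB.
    - by rewrite fdisjoint_sym.
    - by rewrite fsetUC.
    by exists b, a; rewrite mkedgeC.
  move: dA dB; rewrite -!fsetI_eq0 => /fset0Pn[a] /[swap] /fset0Pn[b].
  rewrite !in_fsetI => /andP[bB bN] /andP[aA aN].
  exists a, b; split=> //; apply: delv_edge.
  - exact: nbr_neq wG aN.
  - exact: nbr_neq wG bN.
  apply: sim => //; apply/eqP => ab; move/fdisjointP: dis => /(_ _ aA).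
  by rewrite ab bB.
move=> AV BV dis A0 B0 hc dN; case: hG => _ h.
have vA : v \notin A by apply/negP => /(fsubsetP AV); rewrite in_fsetD1 eqxx.
have sV (S : {fset nat}) : S `<=` vset G `\ v -> S `<=` vset G.
  by move=> SV; apply: (fsubset_trans SV); apply: fsubD1set.
have [||||a [b [aA]]] := h A (v |` B) (sV _ AV) _ _ A0.
- by rewrite fsubUset fsub1set vG sV.
- by rewrite fdisjointXU dis fdisjointX1 vA.
- by apply/fset0Pn; exists v; rewrite in_fset1U eqxx.
- apply: leq_ltn_trans hc; apply: fsubset_leq_card; apply/fsubsetP => z.
  rewrite !in_fsetD !in_fsetU !in_fset1; case: (z == v) => //=; by rewrite orbT.
rewrite in_fset1U => /orP[/eqP->|bB] ab.
  by move/fdisjointP: dN => /(_ _ aA); rewrite in_nbr mkedgeC ab.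
exists a, b; split=> //; apply: delv_edge => //.
  by apply: contraNneq vA => <-.
by have := fsubsetP BV _ bB; rewrite in_fsetD1 => /andP[].
Qed.

(** Two non-adjacent vertices are separated by the remaining ones, of which there must be at least
    [c]. *)
Lemma cut_complete c G u v : wf_graph G -> cutconn c G -> u \in vset G -> v \in vset G ->
  u != v -> mkedge u v \notin G -> c.+1 < #|` vset G|.
Proof.
move=> wG [cV h] uG vG uv nuv; rewrite ltnNge; apply/negP => lt.
have dis : [disjoint [fset u] & [fset v]]%fset by rewrite fdisjoint1X in_fset1.
have ne z : [fset z] != fset0 :> {fset nat} by apply/fset0Pn; exists z; rewrite in_fset1.
have hc : #|` vset G `\` [fset u; v]| < c.
  have uvG : [fset u; v] `<=` vset G by rewrite fsubUset !fsub1set uG.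
  have := fsubset_leq_card uvG; rewrite cardfsDS // cardfs2 uv /=.
  by move: (#|` vset G|) cV lt => k; lia.
have [||a [b [/fset1P-> /fset1P -> e]]] := h _ _ _ _ dis (ne u) (ne v) hc; rewrite ?fsub1set //.
by rewrite e in nuv.
Qed.

Section LovaszYemini.
Variable M : graph -> {fset edge} -> bool.
Hypothesis hM : graph_matroid_family M.
Variable d : nat.
Hypothesis hd : dimensionality M d.
Hypothesis d_gt0 : 0 < d.
Hypothesis hs : edge_split_preserves_indep M d.

Notation ind := (ind M).
Notation rk := (mrank ind).
Notation kr := (kr M).
Let I0 := ind0 hM.
Let Isub := @ind_sub M hM.
Let Iaug := @ind_aug M hM.

Lemma induced_split S G v : v \in S ->
  induced (S `\ v) G `|` star v (nbr G v `&` S) `<=` induced S G.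
Proof.
move=> vS; rewrite fsubUset induced_mono ?fsubD1set //=.
apply/fsubsetP => e /in_star[x]; rewrite in_fsetI in_nbr => /andP[h xS] ->.
by rewrite mkedge_induced h vS xS.
Qed.

Lemma notin_induced S G v : v \notin vset (induced (S `\ v) G).
Proof. by apply/negP => /(fsubsetP (vset_induced _ _)); rewrite in_fsetD1 eqxx. Qed.

Lemma rk_induced_zero S G v : wf_graph G -> v \in S ->
  rk (induced (S `\ v) G) + minn d #|` nbr G v `&` S| <= rk (induced S G).
Proof.
move=> wG vS; apply: leq_trans (rk_mono I0 (induced_split G vS)).
apply: (rk_zero_ext hM hd); first exact: notin_induced.
by rewrite in_fsetI (negbTE (nbr_self v wG)).
Qed.

(** This is the hypothesis [hf] of the averaging argument. With at most [d] neighbours in [S] the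
    subtracted loss absorbs the deficit and the extra unit; with more, a 0-extension or an edge
    split is used. *)
Lemma rk_induced_one S G v x y : wf_graph G -> v \in S ->
  x \in nbr G v -> y \in nbr G v -> x != y -> rk G < rk (mkedge x y |` G) ->
  rk (induced (S `\ v) G) + d + ((x \in S) && (y \in S)) <=
  rk (induced S G) + (d.+1 - #|` nbr G v `&` S|).
Proof.
move=> wG vS xN yN xy lt; have h0 := rk_induced_zero wG vS.
set a := #|` _| in h0 *.
case: (leqP a d) => ad.
  by rewrite (minn_idPr ad) in h0; move: h0; case: (_ && _) => /=; lia.
rewrite (minn_idPl (ltnW ad)) in h0.
case: (boolP (_ && _)) => [/andP[xS yS]|_]; last by move: h0; lia.
have [|D DS cD] := @subfset_of_card _ ((nbr G v `&` S) `\ x `\ y) d.-1.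
  have := cardfsD1 x (nbr G v `&` S); have := cardfsD1 y ((nbr G v `&` S) `\ x).
  rewrite in_fsetD1 eq_sym xy !in_fsetI xN xS yN yS -/a /= => h1 h2.
  by move: ad; rewrite h2 h1 !add1n !ltnS; case: (d) d_gt0.
have nD z : z \in D -> [&& z != y, z != x, z \in nbr G v & z \in S].
  by move/(fsubsetP DS); rewrite !in_fsetD1 in_fsetI.
set D' := x |` (y |` D).
have cD' : #|` D'| = d.+1.
  rewrite /D' !cardfsU1 cD in_fset1U (negbTE xy) /=.
  have -> : x \notin D by apply/negP => /nD; rewrite eqxx andbF.
  have -> : y \notin D by apply/negP => /nD; rewrite eqxx.
  by rewrite !add1n prednK.
have D'S : D' `<=` nbr G v `&` S.
  apply/fsubsetP => z; rewrite !in_fset1U in_fsetI => /or3P[/eqP->|/eqP->|/nD/and4P[_ _ -> ->]//].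
    by rewrite xN.
  by rewrite yN.
have vD : v \notin D'.
  by apply/negP => /(fsubsetP D'S); rewrite in_fsetI (negbTE (nbr_self v wG)).
set Z := induced (S `\ v) G.
(* An edge not spanned by [G] is not spanned by its subgraph [Z]. *)
have ltZ : rk Z < rk (mkedge x y |` Z).
  have := rk_connectivity_mono I0 Isub Iaug [fset mkedge x y] (induced_sub (S `\ v) G).
  rewrite -/Z !(fsetUC _ [fset _]) => h.
  by move: h lt; lia.
have := rk_one_ext hM hd d_gt0 hs (notin_induced S G v) vD _ _ xy cD' ltZ.
rewrite !in_fset1U !eqxx orbT => /(_ isT isT) h1.
have : Z `|` star v D' `<=` induced S G.
  apply: fsubset_trans (induced_split G vS); apply: fsetUS.
  by apply/fsubsetP => e /in_star[z zD ->]; rewrite mem_star; apply: (fsubsetP D'S).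
move/(rk_mono I0); rewrite -/Z in h1 *; move: h1; lia.
Qed.

Lemma lovasz_yemini_cut : exists c, forall G, wf_graph G -> cutconn c G ->
  rk G = kr #|` vset G|.
Proof.
have [N hN] := kr_succ hM hd; have [b hb] := kr_bound hM hd.
(* The first term is the degree required by [potential_bound], [N] puts [kr] in its linear range,
   and [4 * b] defeats the additive constant of [kr_bound]. *)
set c := 12 * (d.+1 * d.+1) + N + 4 * b + 2.
have c1 : 1 < c by rewrite /c; lia.
exists c => G.
have [n le_n] := ubnP #|` vset G|; elim: n G le_n => // n IHn G le_n.
have [m le_m] := ubnP #|` complete (vset G) `\` G|.
elim: m G le_n le_m => // m IHm G le_n le_m wG hG.
have cV := hG.1.
set K := complete (vset G).
have GK : G `<=` K by rewrite sub_complete.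
(* A spanned edge can be added: rank, vertex set and connectivity are kept, and fewer edges are
   missing. *)
case: (boolP (has (fun e => (e \notin G) && (rk (e |` G) == rk G)) K)).
  case/hasP => e eK /andP[eG /eqP re].
  have wG' : wf_graph (e |` G) by apply: wf_sub (@wf_complete (vset G)); rewrite fsubUset fsub1set eK.
  have vE : vset (e |` G) = vset G.
    apply/eqP; rewrite eqEfsubset (vset_sub (fsubsetU1 _ _)) andbT -sub_complete //.
    by rewrite fsubUset fsub1set eK.
  rewrite -re -vE; apply: IHm => //; rewrite ?vE //.
    have -> : complete (vset G) `\` (e |` G) = (K `\` G) `\ e.
      by apply/fsetP => g; rewrite in_fsetD1 !in_fsetD in_fset1U negb_or andbA.
    by move: le_m; rewrite (cardfsD1 e (_ `\` G)) in_fsetD eG eK.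
  split; rewrite vE // => A B AV BV dis A0 B0 hc.
  have [a [b' [aA bB ab]]] := hG.2 A B AV BV dis A0 B0 hc.
  by exists a, b'; rewrite in_fset1U ab orbT.
rewrite -all_predC => /allP closed.
case: (eqVneq G K) => [->|GnK].
  by rewrite /K rk_complete // vset_complete // (leq_trans _ cV) // ltnW.
have cV2 : c.+1 < #|` vset G|.
  have /fset0Pn[e] : K `\` G != fset0.
    by apply: contraNneq GnK => /eqP; rewrite fsetD_eq0 => KG; rewrite eqEfsubset GK.
  rewrite in_fsetD => /andP[eG eK]; have we := wf_complete eK.
  move: eG eK; rewrite -(mkedgeE we) mkedge_complete => eG /and3P[h1 h2 h3].
  exact: (cut_complete wG hG h1 h2 h3 eG).
pose bad (p : nat * nat) := (p.1 != p.2) && (mkedge p.1 p.2 \notin G).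
pose prs v := [seq (x, y) | x <- (nbr G v : seq nat), y <- (nbr G v : seq nat)].
case: (boolP (has (fun v => ~~ has bad (prs v)) (vset G))).
  (* Here [v] is simplicial and [delv v G] is rigid by induction; restoring [v] adds at least [d] to
     the rank, while [kr] grows by exactly [d]. *)
  case/hasP => v vG /hasPn sim.
  have sim' : {in nbr G v &, forall x y, x != y -> mkedge x y \in G}.
    move=> x y xN yN xy; apply/negPn; apply/negP => nG.
    have := sim (x, y); rewrite /bad /= xy nG => /(_ _) h.
    by move: h; rewrite allpairs_f // => /(_ isT).
  have hG' := cut_delv_simplicial c1 wG hG vG cV2 sim'.
  have vE := vset_delv v c1 wG hG.
  have cE := cardfsD1 v (vset G); rewrite vG add1n in cE.
  have := IHn (delv v G); rewrite vE => /(_ _ (wf_delv wG) hG') h.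
  apply/eqP; rewrite eqn_leq rk_le_kr //= cE hN; last by move: cE cV2; rewrite /c; lia.
  rewrite -h; last by move: le_n; rewrite cE.
  have := rk_induced_zero wG vG; rewrite induced_full; apply: leq_trans.
  rewrite leq_add2l leq_min leqnn /=.
  have -> : nbr G v `&` vset G = nbr G v by apply/fsetIidPl/nbr_vset.
  by apply: leq_trans (cut_deg wG hG vG); rewrite /c; lia.
rewrite -all_predC => /allP nonsim.
(* The default [(0, 0)] is never returned at a vertex of [G], since each has a bad pair. *)
pose xy v := nth (0, 0) (prs v) (find bad (prs v)).
have hxy v : v \in vset G ->
    [/\ (xy v).1 \in nbr G v, (xy v).2 \in nbr G v, (xy v).1 != (xy v).2 &
        rk G < rk (mkedge (xy v).1 (xy v).2 |` G)].
  move=> /nonsim /= /negPn hh; have := nth_find (0, 0) hh; rewrite -/(xy v) => /andP[ne nG].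
  have : xy v \in prs v by apply: mem_nth; rewrite -has_find.
  case/allpairsP => -[x y] /= [xN yN e]; move: ne nG; rewrite e /= => ne nG.
  split=> //; have eK : mkedge x y \in K.
    by rewrite mkedge_complete ne !(fsubsetP (nbr_vset G v)).
  have := closed _ eK; rewrite /= nG /= => ne'.
  by rewrite ltn_neqAle eq_sym ne' (rk_mono I0 (fsubsetU1 _ _)).
have hf S v : S `<=` vset G -> v \in S ->
    rk (induced (S `\ v) G) + d + (((xy v).1 \in S) && ((xy v).2 \in S)) <=
    rk (induced S G) + (d.+1 - #|` nbr G v `&` S|).
  by move=> SV vS; have [h1 h2 h3 h4] := hxy _ (fsubsetP SV _ vS); apply: rk_induced_one.
have hV v : v \in vset G ->
    [/\ (xy v).1 \in vset G, (xy v).2 \in vset G & c <= #|` nbr G v `&` vset G|].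
  move=> vG; have [h1 h2 _ _] := hxy _ vG; rewrite !(fsubsetP (nbr_vset G v)) //.
  by rewrite (fsetIidPl (nbr_vset G v)); split=> //; apply: cut_deg.
have hc : 12 * (d.+1 * d.+1) <= c by rewrite /c; lia.
have := potential_bound (fun v _ => nbr_self v wG) hf hV hc.
(* With r(G) at most [d * k + b] on [k] vertices this forces [k] to be at most [4 * b], against
   [cV]. *)
rewrite induced_full => lower.
have := rk_le_kr hM wG (fsubset_refl _); have := hb #|` vset G|.
move: lower cV; rewrite /c; move: (#|` vset G|) (rk G) (kr _) => k r s.
nia.
Qed.

End LovaszYemini.

(** * The Whitney property *)

Lemma nbrU A B v : nbr (A `|` B) v = nbr A v `|` nbr B v.
Proof. by apply/fsetP => x; rewrite in_fsetU !in_nbr in_fsetU. Qed.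

Lemma inducedU S A B : induced S (A `|` B) = induced S A `|` induced S B.
Proof.
by apply/fsetP => e; rewrite in_fsetU !in_induced in_fsetU andb_orl.
Qed.

Lemma nbr_vset_neq0 G v : wf_graph G -> v \in vset G -> 0 < #|` nbr G v|.
Proof.
move=> wG /in_vsetP[e eG ie]; have [x _ ee] := inc_wf_edge (wG _ eG) ie.
by rewrite cardfs_gt0; apply/fset0Pn; exists x; rewrite in_nbr -ee.
Qed.

Section Whitney.
Variable M : graph -> {fset edge} -> bool.
Hypothesis hM : graph_matroid_family M.
Variable d : nat.
Hypothesis hd : dimensionality M d.
Hypothesis d_gt0 : 0 < d.

Notation ind := (ind M).
Notation rk := (mrank ind).
Notation kr := (kr M).
Let I0 := ind0 hM.
Let Isub := @ind_sub M hM.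
Let Iaug := @ind_aug M hM.

Variables (c N b : nat).
Hypothesis rigid_c : forall G, wf_graph G -> cutconn c G -> rk G = kr #|` vset G|.
Hypothesis kr_step : forall n, N <= n -> kr n.+1 = kr n + d.
Hypothesis kr_le : forall n, kr n <= d * n + b.
Hypothesis c_gt1 : 1 < c.
Hypothesis N_le_c : N <= c.

Lemma rk_del_zero S A v : wf_graph A ->
  rk (induced (S `\ v) A) + minn d #|` nbr A v| <= rk A.
Proof.
move=> wA; have h := rk_zero_ext hM hd (notin_induced S A v) (nbr_self v wA).
apply: (leq_trans h); apply: (rk_mono I0); rewrite fsubUset induced_sub /=.
by apply/fsubsetP => e /in_star[x]; rewrite in_nbr => xA ->.
Qed.

Lemma rk_delv G v : wf_graph G -> cutconn c.+1 G -> v \in vset G ->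
  rk G = rk (delv v G) + d.
Proof.
move=> wG hG vG; have c0 := ltnW c_gt1.
have hG' := cut_delv c0 wG hG vG.
have vE := @vset_delv c.+1 G v c0 wG hG.
rewrite rigid_c //; last exact: cut_mono hG.
rewrite (rigid_c (wf_delv wG) hG') vE.
have cE := cardfsD1 v (vset G); rewrite vG add1n in cE.
by rewrite cE kr_step //; move: hG.1; rewrite cE; lia.
Qed.

(** One unit of [t] is spent per deleted vertex, [2 * d] forces degree at least [d] on one side at
    that vertex, and [c] keeps the graphs rigid. *)
Definition vconn t := c + t + 2 * d + 2.

(* Deleting a vertex incident with both sides lowers the connectivity
   [rk A + rk B - rk G] by at least one. *)
Lemma vertical_connectivity t G A B : wf_graph G -> cutconn (vconn t) G ->
  A `|` B = G -> rk A + rk B < rk G + t -> rk A = rk G \/ rk B = rk G.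
Proof.
elim: t G A B => [|t IH] G A B wG hG AB lt.
  by have := rk_subadd I0 Isub Iaug A B; rewrite AB; move: lt; rewrite addn0; lia.
have AG : A `<=` G by rewrite -AB fsubsetUl.
have BG : B `<=` G by rewrite -AB fsubsetUr.
have wA := wf_sub AG wG; have wB := wf_sub BG wG.
have vAB : vset A `|` vset B = vset G by rewrite -vsetU AB.
(* Nonempty sides without a common vertex would disconnect [G]. *)
case: (boolP [disjoint vset A & vset B]%fset) => [dis|].
  case: (fset_0Vmem A) => [A0|[e eA]]; first by right; rewrite -AB A0 fset0U.
  case: (fset_0Vmem B) => [B0|[f fB]]; first by left; rewrite -AB B0 fsetU0.
  have nz (F : graph) g : g \in F -> vset F != fset0.
    by move=> gF; apply/fset0Pn; exists g.1; apply/in_vsetP; exists g; rewrite // /inc eqxx.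
  have [] := hG.2 (vset A) (vset B) (vset_sub AG) (vset_sub BG) dis (nz _ _ eA) (nz _ _ fB).
    by rewrite vAB fsetDv cardfs0 /vconn; lia.
  move=> x [y [xA yB]]; rewrite -AB in_fsetU => /orP[] /vset_edge /andP[h1 h2].
    by move/fdisjointP: dis => /(_ _ h2); rewrite yB.
  by move/fdisjointP: dis => /(_ _ xA); rewrite h1.
rewrite -fsetI_eq0 => /fset0Pn[v]; rewrite in_fsetI => /andP[vA vB].
have vG : v \in vset G by rewrite -vAB in_fsetU vA.
have rG : rk G = rk (delv v G) + d.
  by apply: rk_delv => //; apply: cut_mono hG; rewrite /vconn; lia.
have hG' : cutconn (vconn t) (delv v G).
  by apply: cut_delv => //; [rewrite /vconn; lia | apply: cut_mono hG; rewrite /vconn; lia].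
set A' := induced (vset G `\ v) A; set B' := induced (vset G `\ v) B.
have AB' : A' `|` B' = delv v G by rewrite -inducedU AB.
have hA := rk_del_zero (vset G) v wA; have hB := rk_del_zero (vset G) v wB.
rewrite -/A' -/B' in hA hB.
have a0 := nbr_vset_neq0 wA vA; have b0 := nbr_vset_neq0 wB vB.
have sA := nbr_le_rk hM hd d_gt0 v wA; have sB := nbr_le_rk hM hd d_gt0 v wB.
have deg : vconn t.+1 <= #|` nbr A v| + #|` nbr B v|.
  apply: leq_trans (cut_deg wG hG vG) _; rewrite -AB nbrU cardfsU; exact: leq_subr.
have mA := rk_mono I0 AG; have mB := rk_mono I0 BG.
(* One side has degree at least [d] at [v] and the other has positive degree, so the two ranks lose
   at least [d + 1] together while that of [G] loses [d]. If [A'] spans but [A] does not, [v] has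
   degree less than [d] in [A], and its star in [B] is too large for [lt]. *)
have [] := IH _ A' B' (wf_delv wG) hG' AB'.
- move: hA hB a0 b0 deg lt rG; rewrite /vconn.
  move: (#|` nbr A v|) (#|` nbr B v|) => p q.
  by move: (rk A) (rk B) (rk A') (rk B') (rk G) (rk (delv v G)); lia.
- move=> e; left; move: hA sB deg lt rG mA e; rewrite /vconn.
  move: (#|` nbr A v|) (#|` nbr B v|) => p q.
  by move: (rk A) (rk B) (rk A') (rk G) (rk (delv v G)); lia.
- move=> e; right; move: hB sA deg lt rG mB e; rewrite /vconn.
  move: (#|` nbr A v|) (#|` nbr B v|) => p q.
  by move: (rk A) (rk B) (rk B') (rk G) (rk (delv v G)); lia.
Qed.

(** The first three terms bound the connectivity across a vertex cut of size at most [s]; [s + 1]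
    makes the degrees exceed [s]. *)
Definition sepbound s := d * s + b + d * d + s + 1.

(** Local connectivity only grows when both sides are completed to cliques, and for cliques it is
    bounded by [rk_add_clique] and [kr_le]. *)
Lemma rk_separation H P Q X : wf_graph H ->
  [disjoint P & Q]%fset -> [disjoint X & Q]%fset ->
  rk (induced (P `|` X) H) + rk (induced (Q `|` X) H) <=
  rk (induced (P `|` X) H `|` induced (Q `|` X) H) + d * #|` X| + b + d * d.
Proof.
move=> wH dPQ dXQ; set H1 := induced (P `|` X) H; set H2 := induced (Q `|` X) H.
set K1 := complete (P `|` X); set K2 := complete (Q `|` X).
have HK S : induced S H `<=` complete S.
  by rewrite sub_complete ?vset_induced //; apply: wf_sub (induced_sub _ _) wH.
have m1 := rk_connectivity_mono I0 Isub Iaug H2 (HK (P `|` X)).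
have m2 := rk_connectivity_mono I0 Isub Iaug K1 (HK (Q `|` X)).
rewrite -/H1 -/K1 -/H2 -/K2 (fsetUC H2 K1) in m1 m2.
have dK : [disjoint vset K1 & Q]%fset.
  have : vset K1 `<=` P `|` X by rewrite -sub_complete //; apply: wf_complete.
  by move/fdisjointWl; apply; rewrite fdisjointUX dPQ.
have m3 := rk_add_clique hM hd dK.
have m4 : rk (K1 `|` complete Q) <= rk (K2 `|` K1).
  apply: (rk_mono I0); rewrite (fsetUC K2); apply: fsetUS; apply: complete_sub.
  exact: fsubsetUl.
have m5 : rk K2 <= d * (#|` Q| + #|` X|) + b.
  rewrite /K2 rk_complete //; apply: leq_trans (kr_le _) _.
  by rewrite leq_add2r leq_mul2l cardfsU leq_subr orbT.
move: m1 m2 m3 m4 m5; rewrite mulnDr.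
move: (rk K1) (rk K2) (rk H1) (rk H2) (rk (H1 `|` H2)) (rk (K1 `|` H2)) => k1 k2 h1 h2 h12 kh.
move: (rk (K2 `|` K1)) (rk (K1 `|` complete Q)) (d * #|` Q|) (d * #|` X|) (d * d) => *; lia.
Qed.

(** * Transfer of connectivity along a matroid isomorphism *)

Section Iso.
Variables (s : nat) (G H : graph) (psi : edge -> edge).
Hypothesis wG : wf_graph G.
Hypothesis wH : wf_graph H.
Hypothesis hG : cutconn (vconn (sepbound s)) G.
Hypothesis psi_img : [fset psi e | e in G] = H.
Hypothesis psi_rk : forall F, F `<=` G -> rk [fset psi e | e in F] = rk F.
Let t := sepbound s.

Lemma iso_vertical_connectivity A B : A `|` B = H -> rk A + rk B < rk H + t ->
  rk A = rk H \/ rk B = rk H.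
Proof.
move=> AB; pose pre (F : graph) := [fset e in G | psi e \in F].
have preG F : pre F `<=` G by apply/fsubsetP => e; rewrite !inE /= => /andP[].
have preE F : F `<=` H -> [fset psi e | e in pre F] = F.
  move=> FH; apply/fsetP => y; apply/imfsetP/idP => /= [[e eF ->]|yF].
    by move: eF; rewrite !inE /= => /andP[].
  have := fsubsetP FH _ yF; rewrite -psi_img => /imfsetP[e /= eG ye].
  by exists e => //; rewrite !inE /= eG -ye.
have AH : A `<=` H by rewrite -AB fsubsetUl.
have BH : B `<=` H by rewrite -AB fsubsetUr.
have rA : rk (pre A) = rk A by rewrite -psi_rk ?preE.
have rB : rk (pre B) = rk B by rewrite -psi_rk ?preE.
have rH : rk H = rk G by rewrite -psi_img psi_rk.
rewrite rH -rA -rB; apply: vertical_connectivity => //.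
apply/fsetP => e; rewrite in_fsetU !inE /= -andb_orr -in_fsetU AB.
case eG: (e \in G) => //=; rewrite -psi_img; exact: in_imfset.
Qed.

(** A smaller star at [w], against the rest of [H], would be a separation with neither side
    spanning: the star has rank below [t], and the rest misses [w]. *)
Lemma iso_deg w : w \in vset H -> t <= #|` nbr H w|.
Proof.
move=> wHv; rewrite leqNgt; apply/negP => lt.
set D := #|` nbr H w| in lt.
set H0 := induced (vset H `\ w) H; set B := star w (nbr H w).
have BH : B `<=` H by apply/fsubsetP => e /in_star[x]; rewrite in_nbr => h ->.
have HE : H0 `|` B = H.
  apply/eqP; rewrite eqEfsubset fsubUset BH induced_sub /=; apply/fsubsetP => e eH.
  rewrite in_fsetU; case: (boolP (inc w e)) => [ie|].
    have [x _ ee] := inc_wf_edge (wH eH) ie; rewrite ee mem_star in_nbr -ee eH.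
    by rewrite orbT.
  rewrite negb_or => /andP[e1 e2]; apply/orP; left.
  rewrite in_induced eH !in_fsetD1 e1 e2 /=.
  by apply/andP; split; apply/in_vsetP; exists e; rewrite // /inc eqxx ?orbT.
have h0 := rk_del_zero (vset H) w wH; rewrite -/H0 -/D in h0.
have D0 : 0 < D by apply: nbr_vset_neq0.
have rB : rk B = D by rewrite (rk_indep I0) ?card_star //; apply: (ind_star hM hd d_gt0); apply: nbr_self.
have rHG : rk H = rk G by rewrite -psi_img psi_rk.
have [v vG] : exists v, v \in vset G.
  by apply/fset0Pn; rewrite -cardfs_gt0; apply: leq_trans hG.1.
have hv := leq_trans (cut_deg wG hG vG) (nbr_le_rk hM hd d_gt0 v wG).
have := iso_vertical_connectivity HE; rewrite rB => -[]; move: h0 hv lt D0; rewrite rHG /vconn -/t; lia.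
Qed.

Lemma iso_cutconn : cutconn s H.
Proof.
have [e eH] : exists e, e \in H.
  have [v /in_vsetP[e eG _]] : exists v, v \in vset G.
    by apply/fset0Pn; rewrite -cardfs_gt0; apply: leq_trans hG.1.
  by exists (psi e); rewrite -psi_img; apply: in_imfset.
split.
  have eV : e.1 \in vset H by apply/in_vsetP; exists e; rewrite // /inc eqxx.
  apply: leq_trans (fsubset_leq_card (nbr_vset H e.1)); apply: leq_trans (iso_deg eV).
  by rewrite /t /sepbound; lia.
move=> P Q PV QV dis /fset0Pn[p pP] /fset0Pn[q qQ] cX.
set X := vset H `\` (P `|` Q) in cX.
case: (boolP (has (fun ab => mkedge ab.1 ab.2 \in H)
   [seq (x, y) | x <- (P : seq nat), y <- (Q : seq nat)])).
  by case/hasP => -[x y] /allpairsP[[x' y'] [xP yQ [-> ->]]] h; exists x', y'.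
move/hasPn => none.
have nPQ x y : x \in P -> y \in Q -> mkedge x y \notin H.
  by move=> xP yQ; apply: (none (x, y)); apply: allpairs_f.
have dXQ : [disjoint X & Q]%fset.
  by apply/fdisjointP => z; rewrite in_fsetD in_fsetU negb_or => /andP[/andP[]].
have sep := rk_separation wH dis dXQ.
set H1 := induced (P `|` X) H in sep; set H2 := induced (Q `|` X) H in sep.
have inX z : z \in vset H -> [|| z \in P, z \in Q | z \in X].
  by move=> zH; rewrite in_fsetD in_fsetU zH; case: (z \in P); case: (z \in Q).
have HE : H1 `|` H2 = H.
  apply/eqP; rewrite eqEfsubset fsubUset !induced_sub /=; apply/fsubsetP => f fH.
  have wf := wH fH; rewrite -(mkedgeE wf) in fH *.
  have /andP[/inX h1 /inX h2] := vset_edge fH.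
  rewrite in_fsetU !mkedge_induced fH !in_fsetU /=.
  move: (nPQ f.1 f.2) (nPQ f.2 f.1); rewrite [mkedge f.2 _]mkedgeC fH.
  by case/or3P: h1 => ->; case/or3P: h2 => ->; rewrite ?orbT // => h3 h4;
    [have := h3 isT isT|have := h4 isT isT].
rewrite HE in sep.
have dX : d * #|` X| <= d * s by rewrite leq_mul2l ltnW ?orbT.
have deg1 : t <= rk H1.
  apply: leq_trans (iso_deg (fsubsetP PV _ pP)) _.
  have -> : nbr H p = nbr H1 p.
    apply/fsetP => z; rewrite !in_nbr mkedge_induced !in_fsetU pP /=.
    case h: (mkedge p z \in H) => //=; have /andP[_ /inX] := vset_edge h.
    by case/or3P => [->|zQ|->]; rewrite ?orbT //; have := nPQ _ _ pP zQ; rewrite h.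
  by apply: (nbr_le_rk hM hd d_gt0); apply: wf_sub (induced_sub _ _) wH.
have deg2 : t <= rk H2.
  apply: leq_trans (iso_deg (fsubsetP QV _ qQ)) _.
  have -> : nbr H q = nbr H2 q.
    apply/fsetP => z; rewrite !in_nbr mkedge_induced !in_fsetU qQ /=.
    case h: (mkedge q z \in H) => //=; have /andP[_ /inX] := vset_edge h.
    by case/or3P => [zP|->|->]; rewrite ?orbT //; have := nPQ _ _ zP qQ; rewrite mkedgeC h.
  by apply: (nbr_le_rk hM hd d_gt0); apply: wf_sub (induced_sub _ _) wH.
(* If one side spanned, [sep] would bound the rank of the other below [t], yet each side contains a
   full star with at least [t] edges. *)
have := iso_vertical_connectivity HE.
move: sep dX deg1 deg2; rewrite /t /sepbound.
move: (rk H1) (rk H2) (rk H) (d * #|` X|) (d * s) (d * d) => *; exfalso; lia.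
Qed.

End Iso.

(** Positivity matters: [kr 0] and [kr 1] are both zero, and from 1 on [kr] is strictly
    increasing. *)
Lemma kr_inj m n : 0 < m -> 0 < n -> kr m = kr n -> m = n.
Proof.
wlog mn : m n / m < n.
  move=> h m0 n0 e; case: (ltngtP m n) => // l; first exact: h.
  by apply/esym; apply: h.
move=> m0 _ e; have := kr_succ_ge hM hd m; have := kr_mono hM mn; rewrite -e.
lia.
Qed.

(** The extra unit of connectivity makes [card_iso] available for every [delv v G] as well as for
    [G]. *)
Lemma cut_reconstructible G : wf_graph G -> cutconn (vconn (sepbound c)).+1 G ->
  reconstructible M G.
Proof.
move=> wG hG H psi wH [pinj pimg pM].
have pind F : F `<=` G -> ind F = ind [fset psi e | e in F].
  move=> FG; rewrite -(family_restrict hM wG FG) pM // (family_restrict hM wH) //.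
  by rewrite -pimg; apply: subset_imfset; apply/fsubsetP.
have prk F : F `<=` G -> rk [fset psi e | e in F] = rk F.
  move=> FG; apply: rk_imfset => //.
    by move=> x y /(fsubsetP FG) xG /(fsubsetP FG) yG; apply: pinj.
  by move=> F' F'F; apply: pind; apply: fsubset_trans FG.
have psub F : F `<=` G -> [fset psi e | e in F] `<=` H.
  by move=> FG; rewrite -pimg; apply: subset_imfset; apply/fsubsetP.
have card_iso F : F `<=` G -> cutconn (vconn (sepbound c)) F ->
    #|` vset [fset psi e | e in F]| = #|` vset F|.
  move=> FG hF; have wF := wf_sub FG wG.
  have wF' := wf_sub (psub _ FG) wH.
  have hF' : cutconn c [fset psi e | e in F].
    apply: iso_cutconn hF _ _ => // F' F'F; apply: prk.
    by apply: fsubset_trans FG.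
  have hFc : cutconn c F by apply: cut_mono hF; rewrite /vconn; lia.
  apply: kr_inj; [exact: leq_trans hF'.1|exact: leq_trans hFc.1|].
  by rewrite -!rigid_c // prk.
have v1 : 1 < (vconn (sepbound c)).+1 by rewrite /vconn; lia.
have c0 : 0 < vconn (sepbound c) by rewrite /vconn; lia.
have cG : #|` vset H| = #|` vset G|.
  by rewrite -pimg; apply: card_iso => //; apply: cut_mono hG.
pose G_ v := delv v G; pose H_ v := [fset psi e | e in G_ v].
have GG v : G_ v `<=` G by apply: induced_sub.
have vGE v : vset (G_ v) = vset G `\ v by apply: vset_delv v1 wG hG.
have cH v : v \in vset G -> #|` vset (H_ v)|.+1 = #|` vset H|.
  move=> vG; rewrite card_iso //; last exact: cut_delv.
  by rewrite vGE cG (cardfsD1 v (vset G)) vG.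
(* The single vertex of [H] missed by the image of [delv v G]; the default 0 does not occur for [v]
   in [vset G]. *)
pose phi v := head 0 (vset H `\` vset (H_ v) : seq nat).
have hphi v : v \in vset G -> (phi v \notin vset (H_ v)) && (phi v \in vset H).
  move=> vG; rewrite -in_fsetD.
  have : 0 < #|` vset H `\` vset (H_ v)|.
    by rewrite cardfsDS ?vset_sub ?psub // -(cH v vG) subSnn.
  rewrite /phi -[_ \in _]/(_ \in (enum_fset _)).
  by case: (enum_fset _) => //= a l _; rewrite in_cons eqxx.
have avoid v e : v \in vset G -> e \in G -> ~~ inc v e -> ~~ inc (phi v) (psi e).
  move=> vG eG ie; have /andP[hv _] := hphi v vG; apply: contra hv => ip.
  apply/in_vsetP; exists (psi e) => //; apply: in_imfset => /=.
  rewrite in_induced eG !in_fsetD1; move: ie; rewrite negb_or => /andP[-> ->] /=.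
  by apply/andP; split; apply/in_vsetP; exists e; rewrite // /inc eqxx ?orbT.
have meet v e : e \in G -> inc v e -> inc (phi v) (psi e).
  move=> eG ie; apply/negPn/negP => np.
  (* Otherwise the image of [G_ v] plus [e] lives on one vertex fewer than [H], so its rank is at
     most that of the rigid graph [G_ v]; but [e] is a leaf edge there and raises the rank. *)
  have vG : v \in vset G by apply/in_vsetP; exists e.
  have /andP[hv hvH] := hphi v vG.
  have [x xv ee] := inc_wf_edge (wG _ eG) ie.
  have sub : e |` G_ v `<=` G by rewrite fsubUset fsub1set eG GG.
  have up : rk [fset psi f | f in e |` G_ v] <= kr #|` vset H `\ phi v|.
    apply: rk_le_kr => //; first exact: wf_sub (psub _ sub) wH.
    apply/fsubsetP => z zV; rewrite in_fsetD1 (fsubsetP (vset_sub (psub _ sub)) _ zV) andbT.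
    apply/eqP => zp; move: zV; rewrite zp imfsetU1 vsetU in_fsetU (negbTE hv) orbF.
    by case/in_vsetP => f; rewrite in_fset1 => /eqP->; apply/negP.
  have cHp : #|` vset H `\ phi v| = #|` vset (G_ v)|.
    have := cardfsD1 (phi v) (vset H); rewrite hvH cG (cardfsD1 v (vset G)) vG vGE !add1n.
    by case.
  rewrite prk // cHp -(rigid_c (wf_delv wG)) in up; last first.
    by apply: cut_mono (cut_delv c0 wG hG vG); rewrite /vconn; lia.
  have vx : v \notin [fset x] by rewrite in_fset1 eq_sym.
  have := rk_zero_ext hM hd (notin_induced (vset G) G v) vx.
  have -> : star v [fset x] = [fset e] by rewrite /star imfset_fset1 ee.
  rewrite fsetUC cardfs1 (minn_idPr d_gt0) => h.
  by move: (leq_trans h up); rewrite addn1 ltnn.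
have phi_inj : {in vset G &, injective phi}.
  move=> u v uG vG puv; apply/eqP/negPn/negP => uv.
  (* An edge at [v] that avoids [u] has an image that meets [phi v] and avoids [phi u]. *)
  have /fset0Pn[x] : nbr G v `\ u != fset0.
    rewrite -cardfs_gt0; have := leq_trans v1 (cut_deg wG hG vG).
    by rewrite (cardfsD1 u); case: (u \in _) => /=; lia.
  rewrite in_fsetD1 in_nbr => /andP[xu vx].
  have h1 : inc (phi v) (psi (mkedge v x)) by apply: meet; rewrite // inc_mkedge eqxx.
  have : ~~ inc (phi u) (psi (mkedge v x)).
    by apply: avoid; rewrite // inc_mkedge negb_or uv eq_sym.
  by rewrite puv h1.
have phiE e : e \in G -> psi e = emap phi e.
  move=> eG; have we := wG _ eG.
  have i1 : inc e.1 e by rewrite /inc eqxx.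
  have i2 : inc e.2 e by rewrite /inc eqxx orbT.
  apply: inc2_edge; [|  |exact: meet|exact: meet].
    by apply: wH; rewrite -pimg; apply: in_imfset.
  apply/eqP => /phi_inj h; move: we; rewrite h ?ltnn //; apply/in_vsetP; by exists e.
exists phi; split=> //; split; first by rewrite -vsetE.
by rewrite -pimg; apply: eq_in_imfset => // e eG; rewrite phiE.
Qed.

End Whitney.

Theorem theorem1p3 (M : graph -> {fset edge} -> bool) :
  graph_matroid_family M -> one_extendable M ->
  lovasz_yemini M /\ whitney M.
Proof.
move=> hM [_ _ [d [hd d_gt0 hs]]].
have [c hc] := lovasz_yemini_cut hM hd d_gt0 hs.
have [N hN] := kr_succ hM hd; have [b hb] := kr_bound hM hd.
split.
  exists c => G wG /k_connected_cut hG; rewrite /rigid !rankE //; last exact: wf_complete.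
  by rewrite hc // rk_complete // vsetE.
(* Large enough for rigidity, for [N_le_c] and for [c_gt1] at once. *)
pose c' := c + N + 2.
have hc' G : wf_graph G -> cutconn c' G -> mrank (ind M) G = kr M #|` vset G|.
  by move=> wG hG; apply: hc => //; apply: cut_mono hG; rewrite /c'; lia.
exists (vconn d c' (sepbound d b c')).+1 => G wG /k_connected_cut hG.
by apply: (cut_reconstructible hM hd d_gt0 hc' hN hb _ _ wG hG); rewrite /c'; lia.
Qed.
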